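(* Let $\sigma=(\sigma_j)_{j\in\mathbb N}$ be a non-increasing sequence of non-negative real numbers. If $\sigma\notin\ell_2$, then $\mathcal R_n(\sigma)=\sigma_1$ holds almost surely for all $n\in\mathbb N$. On the other hand, if $\sigma\in\ell_2$, then $$\lim_{n\to\infty}\sqrt n\,\mathbb E[\mathcal R_n(\sigma)]=0.$$
   Context: Convention: $a/0=\infty$ for $a>0$ and $0/0=0$. Put $H_\sigma=\{x\in\ell_2:\sum_{j\in\mathbb N}(x_j/\sigma_j)^2<\infty\}$ and $\mathcal E_\sigma=\{x\in\ell_2:\sum_{j\in\mathbb N}(x_j/\sigma_j)^2\le 1\}$. $G_n=(g_{ij})_{1\le i\le n,\,j\in\mathbb N}$ is a random matrix with independent standard Gaussian entries, and $G_nx=(\sum_{j}g_{ij}x_j)_{i=1}^n$, where a component is assigned the value NaN if its series does not converge. The radius of random information is $$\mathcal R_n(\sigma)=\inf_{\phi}\ \sup_{x\in\mathcal E_\sigma}\|\phi(G_nx)-x\|_2,$$ the infimum being over all mappings $\phi$ from the image of $G_n$ (on $H_\sigma$) to $\ell_2$. *)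

(* Defs.v *)
(* MathComp-Analysis. *)
From mathcomp Require Export all_boot all_order all_algebra.
From mathcomp Require Export all_classical all_reals all_analysis.
Set Implicit Arguments.
Unset Strict Implicit.
Unset Printing Implicit Defensive.
Import Order.TTheory GRing.Theory Num.Theory.
Import numFieldNormedType.Exports.
Local Open Scope classical_set_scope.
Local Open Scope ring_scope.

(* Sequences (x_j)_{j >= 1} are functions on nat, so x_1 is written [x 0]. *)

Definition ell2 {R : realType} : set (nat -> R) :=
  [set x | x \in Lfun (@counting nat R) 2%:E].

Definition ell2_norm {R : realType} (x : nat -> R) : \bar R :=
  ('N[ @counting nat R ]_(2%:E) [EFin \o x])%E.

(* \sum_j (x_j / sigma_j)^2, the division being that of \bar R, in which
   a / 0 = +oo for a > 0, a / 0 = -oo for a < 0 (the sign disappears in the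
   square) and 0 / 0 = 0. *)
Definition weighted_sq {R : realType} (sigma x : nat -> R) : \bar R :=
  (\sum_(0 <= j <oo) ((x j)%:E / (sigma j)%:E) ^+ 2)%E.

Definition Hspace {R : realType} (sigma : nat -> R) : set (nat -> R) :=
  [set x | ell2 x /\ (weighted_sq sigma x < +oo)%E].

Definition ellipsoid {R : realType} (sigma : nat -> R) : set (nat -> R) :=
  [set x | ell2 x /\ (weighted_sq sigma x <= 1)%E].

(* None plays the role of NaN: it is the value of a component whose series
   does not converge in R. *)
Definition info {R : realType} (n : nat) (A : 'I_n -> nat -> R) (x : nat -> R) :
    'I_n -> option R := fun i =>
  let S := series (fun j => A i j * x j) in
  if `[< cvgn S >] then Some (limn S) else None.

(* A map from the image of [info A] on [Hspace sigma] to ell2 is rendered by a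
   total function sending this image into ell2; its values outside of the image
   are not used since [ellipsoid sigma] is a subset of [Hspace sigma]. *)
Definition radius {R : realType} (sigma : nat -> R) (n : nat)
    (A : 'I_n -> nat -> R) : \bar R :=
  ereal_inf [set ereal_sup [set ell2_norm (phi (info A x) \- x)
                           | x in ellipsoid sigma]
            | phi in [set phi : ('I_n -> option R) -> (nat -> R)
                     | set_fun (info A @` Hspace sigma) ell2 phi]].

Definition mutually_independent d (T : measurableType d) (R : realType)
    (P : probability T R) (I : eqType) (X : I -> {RV P >-> R}) : Prop :=
  forall (s : seq I) (B : I -> set R), uniq s ->
    (forall i, measurable (B i)) ->
    P (\bigcap_(i in [set` s]) (X i @^-1` B i)) =
    (\prod_(i <- s) P (X i @^-1` B i))%E.

(* Laws are compared on measurable sets only: elsewhere the value of a measure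
   is unspecified. *)
Definition standard_gaussian d (T : measurableType d) (R : realType)
    (P : probability T R) (X : {RV P >-> R}) : Prop :=
  forall B : set R, measurable B -> distribution P X B = normal_prob 0 1 B.

Definition gaussian_matrix d (T : measurableType d) (R : realType)
    (P : probability T R) (n : nat) (g : 'I_n -> nat -> {RV P >-> R}) : Prop :=
  (forall i j, standard_gaussian (g i j)) /\
  mutually_independent (fun ij : 'I_n * nat => g ij.1 ij.2).

(* The random variable R_n(sigma), for G_n = (g_ij)_{i, j}. *)
Definition radius_random_info d (T : measurableType d) (R : realType)
    (P : probability T R) (sigma : nat -> R) (n : nat)
    (g : 'I_n -> nat -> {RV P >-> R}) (w : T) : \bar R :=
  radius sigma (fun i j => g i j w).

(* Main.v *)
(** If [sigma] is in l2, then off a null set [radius <= 2 * sup |x|] over the [x]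
    in the ellipsoid with [G x = 0], and for such [x] the empirical mean
    [1/n \sum_i |<g_i, x>|] vanishes although its expectation is at least
    [c |x|].  The supremum of the difference is bounded by symmetrization with a
    ghost copy of [G] and by the contraction principle for Rademacher averages,
    which lead to [\sum_j H_j x_j] with [H_j = \sum_i +-g_ij].  For [j >= k] this
    contributes a multiple of [sqrt n * (\sum_(j >= k) sigma_j^2)^(1/2)] to
    [n * E(radius)]; for [j < k] it is compensated by the penalty
    [n c / (4 k) * \sum_(j < k) |x_j|], up to a term bounded in [n].  The second
    factor is small for large [k], then let [n] tend to infinity.

    If [sigma] is not in l2, the Gram matrix of the columns [1..m] of
    [G diag(sigma)] is close to [v * (\sum_(j <= m) sigma_j^2) * Id] in mean
    square, so the first column of [G] can be cancelled by a vector of arbitrarily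
    small weighted norm; hence the kernel of [G] meets the ellipsoid near
    [sigma_1 e_1].

    Of the Gaussian law only symmetry, a positive second moment [v] and a finite
    fourth moment [q] are used. *)
From HB Require Import structures.
Require Import Defs.
From mathcomp Require Import measurable_realfun.
From mathcomp Require Import ring lra.
Set Implicit Arguments.
Unset Strict Implicit.
Unset Printing Implicit Defensive.
Import Order.TTheory GRing.Theory Num.Theory.
Import numFieldNormedType.Exports.
Local Open Scope classical_set_scope.
Local Open Scope ring_scope.

(** * Laws of independent families *)

(** Without the penalty the coordinates [j < k] would contribute, like the tail, a multiple of
    [sqrt n * (\sum_(j < k) sigma_j^2)^(1/2)], and [sqrt n * E(radius)] would merely be bounded. The
    lower bound [n c |x|] has room to spare: half of it pays for two penalties, one for each copy of
    [G]. In return [H_j x_j] exceeds its penalty [bet |x_j|] by at most [|x_j| H_j^2 / (4 bet)],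
    whose mean stays bounded because [E H_j^2 = n v] and [bet] is of order [n]. Measurability shapes
    the rest of this half. The supremum over the ellipsoid is taken over a countable family of
    finitely supported points, and kernel elements are approximated by them for each fixed outcome.
    The radius itself is only majorized pointwise by a measurable function. For the lower bound, [x]
    and [- x] in the kernel give the same information, so no [phi] can approximate both. The null
    set comes from Markov's inequality alone: it is the event that every truncation fails, whose
    probability is at most that of any single failure. *)

Section arrays.
Context {R : realType} {I : choiceType}.

(* Finite intersections of coordinate preimages: a pi-system, on which the laws of
   two independent families with the same marginals agree. *)
Definition cylinders : set (set (I -> R)) :=
  [set C | exists (s : seq I) (B : I -> set R), (forall i, measurable (B i)) /\
     C = \bigcap_(i in [set` s]) [set z | B i (z i)]].

Definition array := g_sigma_algebraType cylinders.

Lemma cylindersI : setI_closed cylinders.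
Proof.
move=> _ _ [s1 [B1 [mB1 ->]]] [s2 [B2 [mB2 ->]]].
pose B i := (if i \in s1 then B1 i else setT) `&` (if i \in s2 then B2 i else setT).
exists (s1 ++ s2), B; split.
  by move=> i; apply: measurableI; case: ifPn.
apply/seteqP; split=> [z [z1 z2] i /= _|z z12].
  by split; case: ifPn => // is_; [exact: z1|exact: z2].
split=> i /= is_; have := z12 i; rewrite /= mem_cat is_ ?orbT => /(_ isT) [].
  by rewrite is_.
by rewrite is_.
Qed.

Lemma measurable_coord (i : I) :
  measurable_fun [set: array] (fun z : array => z i).
Proof.
move=> _ B mB; rewrite setTI; apply: sub_sigma_algebra.
exists [:: i], (fun=> B); split => //.
apply/seteqP; split=> z /=; first by move=> Bz j; rewrite /= inE => /eqP ->.
by apply; rewrite /= inE.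
Qed.

Lemma measurable_array d (T : measurableType d) (X : I -> T -> R) :
  (forall i, measurable_fun setT (X i)) ->
  measurable_fun setT (fun w => (fun i => X i w) : array).
Proof.
move=> mX; apply: (@measurability _ _ T array setT _ cylinders) => //.
move=> _ [_ [s [B [mB ->]]] <-].
rewrite setTI preimage_bigcap; apply: fin_bigcap_measurable; first exact: finite_seq.
by move=> i _; rewrite -[X in measurable X]setTI; apply: (mX i).
Qed.

End arrays.
Arguments array R I : clear implicits.

Section iid.
Context {R : realType} {I : choiceType}.

(** One product formula carries both independence and the common law [mu], the latter being the case
    of a one-element [s]. *)
Definition iid d (T : measurableType d) (P : probability T R)
    (mu : set R -> \bar R) (X : I -> T -> R) : Prop :=
  (forall i, measurable_fun setT (X i)) /\
  forall (s : seq I) (B : I -> set R), uniq s -> (forall i, measurable (B i)) ->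
    P (\bigcap_(i in [set` s]) (X i @^-1` B i)) = (\prod_(i <- s) mu (B i))%E.

End iid.

Section iid_theory.
Context {R : realType} {I : choiceType}.

(** Distributional identities (sign flips, exchange with a ghost copy, passage to a product space)
    all reduce to this: the two laws agree on the pi-system of cylinders, hence everywhere. *)
Lemma iid_law d d' (T : measurableType d) (T' : measurableType d')
    (P : probability T R) (P' : probability T' R) (mu : set R -> \bar R)
    (X : I -> T -> R) (X' : I -> T' -> R) (F : array R I -> \bar R) :
  iid P mu X -> iid P' mu X' ->
  measurable_fun setT F -> (forall z, 0 <= F z)%E ->
  (\int[P]_w F (fun i => X i w) = \int[P']_w F (fun i => X' i w))%E.
Proof.
move=> [mX iX] [mX' iX'] mF F0.
have m := measurable_array mX; have m' := measurable_array mX'.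
pose Y : {mfun T >-> array R I} := HB.pack (fun w => (fun i => X i w) : array R I)
  (isMeasurableFun.Build _ _ _ _ _ m).
pose Y' : {mfun T' >-> array R I} := HB.pack (fun w => (fun i => X' i w) : array R I)
  (isMeasurableFun.Build _ _ _ _ _ m').
rewrite -[LHS](@ge0_integral_distribution _ _ _ _ _ P Y)//.
rewrite -[RHS](@ge0_integral_distribution _ _ _ _ _ P' Y')//.
apply: eq_measure_integral => A mA _.
have := (@measure_unique _ R (array R I) (@cylinders R I) (fun=> setT) erefl cylindersI).
move=> /(_ _ _ (distribution P Y) (distribution P' Y')).
  apply => //.
- by move=> _; exists [::], (fun=> setT); split => //; apply/esym; rewrite -subTset => z _ i.
- by rewrite bigcup_const//; exists 0%N.
- move=> _ [s [B [mB ->]]].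
  (* A cylinder may list a coordinate twice, whereas the product formula requires distinct ones. *)
  rewrite (_ : [set` s] = [set` undup s]); last first.
    by apply/seteqP; split => i /=; rewrite mem_undup.
  exact: (etrans (iX (undup s) B (undup_uniq s) mB)
    (esym (iX' (undup s) B (undup_uniq s) mB))).
- by move=> _; rewrite -ge0_fin_numE ?measure_ge0// fin_num_measure.
Qed.

Lemma iid_reindex (J : choiceType) d (T : measurableType d) (P : probability T R)
    (mu : set R -> \bar R) (X : I -> T -> R) (f : J -> I) (g : I -> J) :
  cancel f g -> iid P mu X ->
  iid P mu (fun j => X (f j)).
Proof.
move=> fg [mX iX]; split => // s B us mB.
have := iX (map f s) (B \o g); rewrite (map_inj_uniq (can_inj fg)).
move=> /(_ us (fun i => mB (g i))); rewrite big_map/=.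
under eq_bigr do rewrite fg.
move=> <-; congr (P _); apply/seteqP; split=> w /= h.
  by move=> i /= /mapP[j js ->]; rewrite /= fg; apply: h.
move=> j /= js; have := h (f j); rewrite /= fg; apply.
exact: map_f.
Qed.

Lemma iid_flip d (T : measurableType d) (P : probability T R)
    (mu : set R -> \bar R) (X : I -> T -> R) (t : I -> bool) :
  (forall B : set R, measurable B -> mu ((fun x : R => - x) @^-1` B) = mu B) ->
  iid P mu X -> iid P mu (fun i w => (-1) ^+ t i * X i w).
Proof.
move=> mu_sym [mX iX]; split=> [i|s B us mB].
  by apply: measurable_funM => //; exact: measurable_cst.
pose B' i := if t i then (fun x : R => - x) @^-1` B i else B i.
have mB' i : measurable (B' i).
  rewrite /B'; case: ifP => // _.
  rewrite -[X in measurable X]setTI; exact: oppr_measurable.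
have := iX s B' us mB'.
rewrite [RHS](eq_bigr (fun i => mu (B i))); last first.
  by move=> i _; rewrite /B'; case: ifP => // _; rewrite mu_sym.
move=> <-; congr (P _); apply/seteqP; split=> w /= h i /= /h; rewrite /B';
  by case: (t i); rewrite /= ?expr1 ?mulN1r ?expr0 ?mul1r.
Qed.

(** The tag [true] reads the second factor of the product space. Separating the constraints by tag
    turns the event into a rectangle. *)
Lemma iid_ghost d (T : measurableType d) (P : probability T R)
    (mu : set R -> \bar R) (X : I -> T -> R) :
  iid P mu X ->
  iid (P \x P)%E mu (fun (bi : bool * I) (w : T * T) => X bi.2 (if bi.1 then w.2 else w.1)).
Proof.
move=> [mX iX]; split=> [[[] i]/=|s B us mB].
- by apply: measurableT_comp => //; exact: measurable_snd.
- by apply: measurableT_comp => //; exact: measurable_fst.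
pose sb b := [seq i.2 | i <- s & i.1 == b].
have usb b : uniq (sb b).
  rewrite map_inj_in_uniq ?filter_uniq// => -[b1 i1] [b2 i2].
  by rewrite !mem_filter /= => /andP[/eqP -> _] /andP[/eqP -> _] ->.
pose A b := \bigcap_(i in [set` sb b]) (X i @^-1` B (b, i)).
have mA b : measurable (A b).
  apply: fin_bigcap_measurable; first exact: finite_seq.
  by move=> i _; rewrite -[X in measurable X]setTI; apply: (mX i).
have PA b : P (A b) = (\prod_(i <- s | i.1 == b) mu (B i))%E.
  rewrite iX// big_map big_filter; apply: eq_bigr => -[b' i] /= /eqP ->//.
rewrite (bigID (fun i => i.1 == false))/= -PA.
under [X in _ = (_ * X)%E]eq_bigl do rewrite eqbF_neg negbK -(eqb_id _.1).
rewrite -PA -product_measure1E//; congr ((P \x P)%E _).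
apply/seteqP; split=> -[w w'] /=.
  move=> h; split=> i /= /mapP[[b j]]; rewrite mem_filter/= => /andP[/eqP -> js ->];
    exact: (h _ js).
move=> [h h'] [[] i] /= js; [apply: h'; apply/mapP; exists (true, i)|apply: h; apply/mapP; exists (false, i)] => //;
  by rewrite mem_filter js.
Qed.

End iid_theory.

(** * Moments of linear forms *)

Lemma measurable_norm {R : realType} d (T : measurableType d) (f : T -> R) :
  measurable_fun setT f -> measurable_fun setT (fun w => `|f w|).
Proof. by move=> mf; exact: measurableT_comp. Qed.

Ltac measurable_tac := repeat (first
  [ assumption
  | apply: measurable_cst
  | apply: measurable_coord
  | apply: measurable_funB
  | apply: measurable_funD
  | apply: measurable_funM
  | apply: measurable_funX
  | apply: measurable_norm
  | (apply: measurable_sum; intro)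
  | match goal with H : forall _, measurable_fun _ _ |- _ => apply H end ]).

(** * Expectations of nonnegative functions, with values in the extended reals *)

Section mean.
Context {R : realType} d (T : measurableType d) (P : probability T R).

Definition mean (f : T -> R) : \bar R := (\int[P]_w (f w)%:E)%E.

Lemma eq_mean (f g : T -> R) : f =1 g -> mean f = mean g.
Proof. by move=> /funext ->. Qed.

Lemma mean_ge0 (f : T -> R) : (forall w, 0 <= f w) -> (0 <= mean f)%E.
Proof. by move=> f0; apply: integral_ge0 => w _; rewrite lee_fin. Qed.

Lemma mean_le (f g : T -> R) : measurable_fun setT f -> measurable_fun setT g ->
  (forall w, 0 <= f w) -> (forall w, f w <= g w) -> (mean f <= mean g)%E.
Proof.
move=> mf mg f0 fg; apply: ge0_le_integral => //.
- by move=> w _; rewrite lee_fin.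
- exact/measurable_EFinP.
- exact/measurable_EFinP.
- by move=> w _; rewrite lee_fin.
Qed.

Lemma mean_cst (c : R) : mean (fun=> c) = c%:E.
Proof. by rewrite /mean integral_cst// [X in (_ * X)%E]probability_setT mule1. Qed.

Lemma meanD (f g : T -> R) : measurable_fun setT f -> measurable_fun setT g ->
  (forall w, 0 <= f w) -> (forall w, 0 <= g w) ->
  mean (fun w => f w + g w) = (mean f + mean g)%E.
Proof.
move=> mf mg f0 g0; rewrite /mean.
under eq_integral do rewrite EFinD.
by rewrite ge0_integralD//; [move=> w _; rewrite lee_fin|exact/measurable_EFinP|
  move=> w _; rewrite lee_fin|exact/measurable_EFinP].
Qed.

Lemma meanZ (c : R) (f : T -> R) : measurable_fun setT f ->
  0 <= c -> (forall w, 0 <= f w) -> mean (fun w => c * f w) = (c%:E * mean f)%E.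
Proof.
move=> mf c0 f0; rewrite /mean.
under eq_integral do rewrite EFinM.
by rewrite ge0_integralZl_EFin//; [move=> w _; rewrite lee_fin|exact/measurable_EFinP].
Qed.

Lemma mean_sum (I : Type) (s : seq I) (f : I -> T -> R) :
  (forall i, measurable_fun setT (f i)) -> (forall i w, 0 <= f i w) ->
  mean (fun w => \sum_(i <- s) f i w) = (\sum_(i <- s) mean (f i))%E.
Proof.
move=> mf f0; rewrite /mean.
under eq_integral do rewrite -sumEFin.
rewrite ge0_integral_sum//.
- by move=> i; exact/measurable_EFinP.
- by move=> i w _; rewrite lee_fin.
Qed.

End mean.

(** * Second and fourth moments, and a lower bound for the first absolute moment *)

Section moments.
Context {R : realType} {I : choiceType} d (T : measurableType d)
  (P : probability T R) (mu : set R -> \bar R) (X : I -> T -> R) (v q : R).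
Hypothesis iX : iid P mu X.
Hypothesis mu_sym :
  forall B : set R, measurable B -> mu ((fun x : R => - x) @^-1` B) = mu B.
Hypothesis v_gt0 : 0 < v.
Hypothesis EX2 : forall i, mean P (fun w => X i w ^+ 2) = v%:E.
Hypothesis EX4 : forall i, mean P (fun w => X i w ^+ 4) = q%:E.

Definition flip (i : I) (z : I -> R) : I -> R := fun j => (-1) ^+ (j == i) * z j.

Let mX i : measurable_fun setT (X i). Proof. exact: (proj1 iX). Qed.

Let marr (F : array R I -> R) : measurable_fun setT F ->
  measurable_fun setT (fun w => F (X^~ w)).
Proof.
move=> mF; apply: (@measurableT_comp _ _ _ _ _ _ F _ (fun w => (X^~ w : array R I))) => //.
exact: measurable_array.
Qed.

Lemma measurable_flip i : measurable_fun setT (flip i : array R I -> array R I).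
Proof.
have h j : measurable_fun setT (fun z : array R I => flip i z j).
  by rewrite /flip; measurable_tac.
exact: (@measurable_array R I _ (array R I) (fun j (z : array R I) => flip i z j) h).
Qed.

(* Averaging over the sign of one coordinate kills the odd terms of [F], so that cross
   terms vanish without integrating functions of variable sign. *)
Lemma mean_flip i (F : array R I -> R) :
  measurable_fun setT F -> (forall z, 0 <= F z) ->
  mean P (fun w => F (X^~ w)) = mean P (fun w => (F (X^~ w) + F (flip i (X^~ w))) / 2).
Proof.
move=> mF F0.
have mF' : measurable_fun setT (fun z : array R I => F (flip i z)).
  exact: (measurableT_comp mF (measurable_flip i)).
have h : mean P (fun w => F (X^~ w)) = mean P (fun w => F (flip i (X^~ w))).
  apply: (iid_law (F := fun z => (F z)%:E) iX
    (iid_flip (fun j => j == i) mu_sym iX)); first exact/measurable_EFinP.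
  by move=> z; rewrite lee_fin.
have m1 := marr mF; have m2 := marr mF'.
transitivity (mean P (fun w => 2^-1 * (F (X^~ w) + F (flip i (X^~ w))))); last first.
  by apply: eq_mean => w; rewrite mulrC.
rewrite meanZ ?invr_ge0//; last 2 first.
- exact: measurable_funD.
- by move=> w; apply: addr_ge0.
by rewrite meanD// -h -mule2n -mule_natl muleA -EFinM mulVf ?mul1e.
Qed.

(** The coefficients may be random as long as they ignore the signs of the coordinates in [s]. This
    covers the off-diagonal Gram entries, linear in one row with coefficients from another. *)
Lemma mean_sum_sqr (s : seq I) (c : I -> array R I -> R) :
  uniq s -> (forall i, measurable_fun setT (c i)) ->
  (forall i l z, i \in s -> l \in s -> c i (flip l z) = c i z) ->
  mean P (fun w => (\sum_(i <- s) c i (X^~ w) * X i w) ^+ 2) =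
  (\sum_(i <- s) mean P (fun w => (c i (X^~ w) * X i w) ^+ 2)%R)%E.
Proof.
move=> + mc; elim: s => [_ _|a s IH /= /andP[as_ us] cs].
  by under eq_mean do rewrite big_nil expr0n/=; rewrite mean_cst big_nil.
pose S (z : array R I) : R := \sum_(i <- s) c i z * z i.
have mS : measurable_fun setT S by rewrite /S; measurable_tac.
rewrite big_cons -IH//; last first.
  by move=> i l z i_s l_s; apply: cs; rewrite inE ?i_s ?l_s orbT.
rewrite -meanD; last first.
- by move=> w; exact: sqr_ge0.
- by move=> w; exact: sqr_ge0.
- by apply: measurable_funX; exact: (marr mS).
- by apply: measurable_funX; apply: measurable_funM => //; exact: (marr (mc a)).
transitivity (mean P (fun w => (S (X^~ w) + c a (X^~ w) * X a w) ^+ 2)).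
  by apply: eq_mean => w; rewrite big_cons addrC.
rewrite (@mean_flip a (fun z : array R I => (S z + c a z * z a) ^+ 2)); last 2 first.
- by measurable_tac.
- by move=> z; exact: sqr_ge0.
apply: eq_mean => w.
have -> : S (flip a (X^~ w)) = S (X^~ w).
  apply: eq_big_seq => i i_s; rewrite cs ?inE ?eqxx ?i_s ?orbT//.
  by rewrite /flip (_ : i == a = false) ?mul1r//; apply: contraNF as_ => /eqP <-.
rewrite cs ?inE ?eqxx// {1}/flip eqxx expr1 -/(S (X^~ w)).
by field.
Qed.

Lemma mean_lin_sqr (s : seq I) (a : I -> R) : uniq s ->
  mean P (fun w => (\sum_(i <- s) a i * X i w) ^+ 2) =
  (v * \sum_(i <- s) a i ^+ 2)%:E.
Proof.
move=> us; rewrite (mean_sum_sqr (c := fun i _ => a i))//.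
rewrite mulr_sumr -sumEFin; apply: eq_bigr => i _.
transitivity (mean P (fun w => a i ^+ 2 * X i w ^+ 2)).
  by apply: eq_mean => w; rewrite exprMn.
rewrite meanZ ?sqr_ge0//; [|by measurable_tac|by move=> w; exact: sqr_ge0].
by rewrite EX2 -EFinM mulrC.
Qed.

Lemma q_ge0 (i : I) : 0 <= q.
Proof.
by rewrite -lee_fin -(EX4 i); apply: mean_ge0 => w; rewrite exprn_even_ge0.
Qed.

(** Induction on [s]: the sign average leaves [S^4 + 6 a^2 S^2 x^2 + a^4 x^4]. The constant 9 closes
    the induction: after AM-GM the middle term costs [9 q a^2 A] twice, which is exactly the cross
    term of [9 q (A + a^2)^2]. *)
Lemma mean_lin_pow4 (s : seq I) (a : I -> R) : uniq s ->
  (mean P (fun w => (\sum_(i <- s) a i * X i w) ^+ 4)%R <=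
  (9 * q * (\sum_(i <- s) a i ^+ 2) ^+ 2)%:E)%E.
Proof.
elim: s => [_|j s IH /= /andP[js us]].
  under eq_mean do rewrite big_nil expr0n/=.
  by rewrite mean_cst big_nil expr0n mulr0.
have q0 := q_ge0 j.
pose S (z : array R I) : R := \sum_(i <- s) a i * z i.
have mS : measurable_fun setT S by rewrite /S; measurable_tac.
have mSX : measurable_fun setT (fun w => S (X^~ w)) by exact: marr.
set A := \sum_(i <- s) a i ^+ 2 in IH.
have A0 : 0 <= A by apply: sumr_ge0 => i _; exact: sqr_ge0.
have S0 w : A = 0 -> S (X^~ w) = 0.
  move=> /eqP; rewrite psumr_eq0 => [/allP h|i _]; last exact: sqr_ge0.
  rewrite /S big_seq big1// => i /h; rewrite /= sqrf_eq0 => /eqP ->.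
  by rewrite mul0r.
rewrite (eq_mean _ (g := fun w => ((S (X^~ w) + a j * X j w) ^+ 4)%R)); last first.
  by move=> w; rewrite big_cons addrC.
rewrite (@mean_flip j (fun z : array R I => ((S z + a j * z j) ^+ 4)%R)); last 2 first.
- by measurable_tac.
- by move=> z; rewrite exprn_even_ge0.
have le1 : (mean P (fun w => ((1 + a j ^+ 2 / A) * S (X^~ w) ^+ 4 +
    (9 * a j ^+ 2 * A + a j ^+ 4) * X j w ^+ 4)%R) <=
    (9 * q * (\sum_(i <- j :: s) a i ^+ 2) ^+ 2)%:E)%E.
  have p4 (x : R) : 0 <= x ^+ 4 by rewrite exprn_even_ge0.
  have ? : 0 <= 1 + a j ^+ 2 / A by rewrite addr_ge0// divr_ge0// ?sqr_ge0.
  have ? : 0 <= 9 * a j ^+ 2 * A + a j ^+ 4.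
    apply: addr_ge0; last exact: p4. apply: mulr_ge0 => //. apply: mulr_ge0 => //. exact: sqr_ge0.
  rewrite meanD; [|by measurable_tac|by measurable_tac|by move=> w; rewrite mulr_ge0|
    by move=> w; rewrite mulr_ge0].
  rewrite !meanZ; [|by measurable_tac|by []|by []|by measurable_tac|by []|by []].
  rewrite EX4 -EFinM.
  apply: (@le_trans _ _ ((1 + a j ^+ 2 / A) * (9 * q * A ^+ 2) +
      (9 * a j ^+ 2 * A + a j ^+ 4) * q)%:E).
    by rewrite [leRHS]EFinD leeD2r// EFinM lee_wpmul2l ?lee_fin// IH.
  rewrite lee_fin big_cons -/A.
  have -> : (1 + a j ^+ 2 / A) * (9 * q * A ^+ 2) = 9 * q * (A ^+ 2 + a j ^+ 2 * A).
    have [->|A_neq0] := eqVneq A 0; first by rewrite expr0n/= !mulr0 addr0 !mulr0.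
    by field.
  have : 0 <= q * a j ^+ 4 by rewrite mulr_ge0.
  by lra.
(* AM-GM: [6 a^2 S^2 x^2 <= (a^2 / A) S^4 + 9 a^2 A x^4] *)
apply: le_trans le1; apply: mean_le.
- by apply: measurable_funM => //; apply: measurable_funD;
    apply: measurable_funX; [|apply: (marr (F := fun z => S (flip j z) + a j * flip j z j))]; rewrite /S /flip; measurable_tac.
- by measurable_tac.
- by move=> w; rewrite divr_ge0// addr_ge0// exprn_even_ge0.
move=> w.
have -> : S (flip j (X^~ w)) = S (X^~ w).
  apply: eq_big_seq => i i_s.
  by rewrite /flip (_ : i == j = false) ?mul1r//; apply: contraNF js => /eqP <-.
rewrite /flip eqxx expr1.
(* For [A = 0] the quotient [a^2 / A] is [0], but then [S] vanishes as well and only [a^4 x^4]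
   remains. *)
have [A_eq0|A_neq0] := eqVneq A 0.
  by rewrite (S0 w A_eq0) A_eq0; lra.
have : 0 <= a j ^+ 2 / A * (S (X^~ w) ^+ 2 - 3 * A * X j w ^+ 2) ^+ 2.
  by rewrite mulr_ge0// ?sqr_ge0// divr_ge0// ?sqr_ge0.
have -> : a j ^+ 2 / A * (S (X^~ w) ^+ 2 - 3 * A * X j w ^+ 2) ^+ 2 =
  a j ^+ 2 / A * S (X^~ w) ^+ 4 - 6 * (a j ^+ 2 * S (X^~ w) ^+ 2 * X j w ^+ 2)
  + 9 * a j ^+ 2 * A * X j w ^+ 4 by field.
by lra.
Qed.

(* Integrate [3 al^2 s^2 <= 2 al^3 |s| + s^4] with [al^2 = (6 p' / u) * \sum a_i^2],
   using [E s^2 = u * \sum a_i^2] and [E s^4 <= 9 p' (\sum a_i^2)^2]; taking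
   [p' = |p| + 1] avoids a division by zero. *)
Definition abs_const (u p : R) : R :=
  let p' := `|p| + 1 in 9 * p' / (2 * (6 * p' / u) * Num.sqrt (6 * p' / u)).

Lemma abs_const_gt0 (u p : R) : 0 < u -> 0 < abs_const u p.
Proof.
move=> u0; have p0 : 0 < `|p| + 1 by rewrite ltr_wpDl.
have k0 : 0 < 6 * (`|p| + 1) / u by rewrite divr_gt0// mulr_gt0.
by rewrite /abs_const !(divr_gt0, mulr_gt0)// sqrtr_gt0.
Qed.

Lemma mean_abs_lin_ge (s : seq I) (a : I -> R) : uniq s ->
  ((abs_const v q * Num.sqrt (\sum_(i <- s) a i ^+ 2))%:E <=
    mean P (fun w => `|\sum_(i <- s) a i * X i w|)%R)%E.
Proof.
rewrite /abs_const; move: (ltr_wpDl (normr_ge0 q) (@ltr01 R)).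
set q' : R := `|q| + 1 => q'0.
have [k k0 kE] : exists2 k : R, 0 < k & k = 6 * q' / v.
  by exists (6 * q' / v) => //; rewrite divr_gt0// mulr_gt0.
rewrite /= -kE.
move=> us; set A := \sum_(i <- s) _.
have A0 : 0 <= A by apply: sumr_ge0 => i _; exact: sqr_ge0.
have [->|A_neq0] := eqVneq A 0.
  by rewrite sqrtr0 mulr0 mean_ge0.
have {A_neq0}A_gt0 : 0 < A by rewrite lt_neqAle eq_sym A_neq0.
pose S w := \sum_(i <- s) a i * X i w.
have mS : measurable_fun setT S by rewrite /S; measurable_tac.
have mS' : measurable_fun setT (fun w => `|S w|) by exact: measurableT_comp.
rewrite -/(mean P (fun w => `|S w|)).
pose al := Num.sqrt k * Num.sqrt A.
have al0 : 0 < al by rewrite mulr_gt0// sqrtr_gt0.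
have al2 : al ^+ 2 = k * A by rewrite exprMn !sqr_sqrtr// ltW.
have h1 : ((3 * al ^+ 2 * (v * A))%:E <=
    (2 * al ^+ 3)%:E * mean P (fun w => `|S w|)%R + (9 * q' * A ^+ 2)%:E)%E.
  apply: (@le_trans _ _ (mean P (fun w => 2 * al ^+ 3 * `|S w| + S w ^+ 4)%R)).
    rewrite EFinM -(mean_lin_sqr a us) -meanZ; last 3 first.
    - by measurable_tac.
    - by apply: mulr_ge0 => //; exact: sqr_ge0.
    - by move=> w; exact: sqr_ge0.
    apply: mean_le.
    - by measurable_tac.
    - by measurable_tac.
    - by move=> w; apply: mulr_ge0; [apply: mulr_ge0 => //|]; exact: sqr_ge0.
    - move=> w; rewrite -/(S w) -subr_ge0.
      have -> : S w ^+ 4 = `|S w| ^+ 4.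
        by rewrite -normrX ger0_norm// exprn_even_ge0.
      have -> : S w ^+ 2 = `|S w| ^+ 2 by rewrite -normrX ger0_norm// sqr_ge0.
      have -> : 2 * al ^+ 3 * `|S w| + `|S w| ^+ 4 - 3 * al ^+ 2 * `|S w| ^+ 2 =
        `|S w| * (`|S w| + 2 * al) * (`|S w| - al) ^+ 2 by ring.
      apply: mulr_ge0; last exact: sqr_ge0.
      by rewrite mulr_ge0// addr_ge0// mulr_ge0// ltW.
  rewrite meanD; [|by measurable_tac|by measurable_tac|by move=> w; rewrite mulr_ge0// mulr_ge0// exprn_ge0// ltW|
    by move=> w; rewrite exprn_even_ge0].
  rewrite meanZ//; last by rewrite mulr_ge0// exprn_ge0// ltW.
  rewrite leeD2l//; apply: (le_trans (mean_lin_pow4 a us)).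
  rewrite lee_fin -/A ler_wpM2r ?sqr_ge0// ler_wpM2l//.
  by rewrite (le_trans (ler_norm _))// lerDl.
case: (mean P _) h1 (mean_ge0 P (fun w => normr_ge0 (S w))) => [r| |] // h1 _; last first.
  by rewrite leey.
move: h1; rewrite -EFinM -EFinD !lee_fin.
have -> : al ^+ 3 = k * A * al by rewrite exprS al2 mulrC.
rewrite al2.
(* The choice of [k] makes the second-moment term twice the fourth-moment bound [9 q' A^2], so half
   of it is left to bound [E |S|] from below. *)
have -> : 3 * (k * A) * (v * A) = 18 * q' * A ^+ 2.
  by rewrite kE; field; rewrite gt_eqF.
move=> h1.
rewrite mulrAC ler_pdivrMr ?mulr_gt0 ?sqrtr_gt0//.
rewrite -(ler_pM2r A_gt0) -(@ler_pM2r _ (Num.sqrt A)) ?sqrtr_gt0//.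
have e : Num.sqrt A * Num.sqrt A = A by rewrite -expr2 sqr_sqrtr.
have -> : 9 * q' * Num.sqrt A * A * Num.sqrt A = 9 * q' * A ^+ 2.
  by rewrite -[in RHS]e; rewrite -{2}e; ring.
have -> : r * (2 * k * Num.sqrt k) * A * Num.sqrt A = 2 * (k * A * al) * r.
  by rewrite /al; ring.
by lra.
Qed.

(** The pair [(X i, X l)] has the law of [X i] on the first factor and [X l] on the second factor of
    the product space, where Tonelli's theorem factors the expectation. *)
Lemma mean_cross (i l : I) : i != l ->
  mean P (fun w => X i w ^+ 2 * X l w ^+ 2) = (v ^+ 2)%:E.
Proof.
move=> il.
pose f (b : bool) := if b then l else i.
have fK : cancel f (fun x => x == l).
  by case; rewrite /f ?eqxx//; apply/negbTE.
have fK' : cancel (fun b => (b, f b)) (@fst bool I) by [].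
pose F (z : array R bool) : \bar R := (z false ^+ 2 * z true ^+ 2)%:E.
have := @iid_law R bool _ _ T _ P (P \x P)%E mu (fun b => X (f b))
  (fun b (w : T * T) => X (f b) (if b then w.2 else w.1)) F
  (iid_reindex fK iX) (iid_reindex fK' (iid_ghost iX)).
rewrite /F /= /mean => ->; last 2 first.
- by apply/measurable_EFinP; measurable_tac.
- by move=> z; rewrite lee_fin mulr_ge0// ?sqr_ge0.
have mX1 : measurable_fun setT (fun w : T * T => X i w.1).
  by apply: measurableT_comp => //; exact: measurable_fst.
have mX2 : measurable_fun setT (fun w : T * T => X l w.2).
  by apply: measurableT_comp => //; exact: measurable_snd.
rewrite (@fubini_tonelli1 _ _ _ _ _ P P)/=; last 2 first.
- by apply/measurable_EFinP; measurable_tac.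
- by move=> z; rewrite lee_fin mulr_ge0// ?sqr_ge0.
transitivity (mean P (fun w => v * X i w ^+ 2)).
  apply: eq_integral => w _; rewrite /fubini_F/= -/(mean P (fun y => X i w ^+ 2 * X l y ^+ 2)).
  rewrite meanZ ?sqr_ge0//; [|by measurable_tac|by move=> y; exact: sqr_ge0].
  by rewrite EX2 -EFinM mulrC.
rewrite meanZ ?ltW//; [|by measurable_tac|by move=> y; exact: sqr_ge0].
by rewrite EX2 -EFinM.
Qed.

End moments.

(** * Contraction and symmetrization *)

Section contraction.
Context {R : realType}.

Definition esup (f : nat -> R) : \bar R := ereal_sup (range (EFin \o f)).

Lemma esup_ge (f : nat -> R) t : ((f t)%:E <= esup f)%E.
Proof. by apply: ereal_sup_ubound; exists t. Qed.

Lemma esup_le (f : nat -> R) c : (forall t, (f t)%:E <= c)%E -> (esup f <= c)%E.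
Proof. by move=> h; apply: ge_ereal_sup => _ [t _ <-]; exact: h. Qed.

Lemma esupD_le (f g : nat -> R) (c : \bar R) :
  (forall x y, (f x + g y)%:E <= c)%E -> (esup f + esup g <= c)%E.
Proof.
case: c => [c|_|h]; last 2 first.
- by rewrite leey.
- by have := h 0%N 0%N; rewrite leeNy_eq.
move=> h.
have hg x : (esup g <= (c - f x)%:E)%E.
  by apply: esup_le => y; rewrite lee_fin lerBrDl -lee_fin.
have : ((g 0%N)%:E <= esup g)%E by exact: esup_ge.
case: (esup g) hg => [r| |] hg h0; last 2 first.
- by have := hg 0%N; rewrite leye_eq.
- by have := h0; rewrite leeNy_eq.
rewrite -leeBrDr//; apply: esup_le => x.
by rewrite -EFinB lee_fin lerBrDr -lerBrDl -lee_fin hg.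
Qed.

Definition sgn_of (e : bool) : R := (-1) ^+ e.

(* For two points [x], [y] and the two signs of coordinate [i0], the bound follows
   by exchanging the roles of [x] and [y] according to the sign of [s i0 y]. *)
Lemma contraction_step n (h : nat -> R) (s s' : 'I_n -> nat -> R) (i0 : 'I_n) :
  (forall i, i != i0 -> s' i = s i) -> (forall t, s' i0 t = `|s i0 t|) ->
  (\sum_(e : {ffun 'I_n -> bool}) esup (fun t => h t + \sum_i sgn_of (e i) * s' i t)%R <=
   \sum_(e : {ffun 'I_n -> bool}) esup (fun t => h t + \sum_i sgn_of (e i) * s i t)%R)%E.
Proof.
move=> ss' s'i0.
pose fl (e : {ffun 'I_n -> bool}) := [ffun i => (i == i0) (+) e i].
have flK : involutive fl by move=> e; apply/ffunP => i; rewrite !ffunE addKb.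
have split_sum (f : {ffun 'I_n -> bool} -> \bar R) :
    (\sum_e f e = \sum_(e : {ffun 'I_n -> bool} | e i0) (f e + f (fl e)))%E.
  rewrite (bigID (fun e : {ffun 'I_n -> bool} => e i0))/= big_split/=.
  congr (_ + _)%E; rewrite (reindex_inj (inv_inj flK))/=.
  by apply: eq_bigl => e; rewrite ffunE eqxx/= negbK.
rewrite !split_sum; apply: lee_sum => e ei0.
pose rest t := h t + \sum_(i | i != i0) sgn_of (e i) * s i t.
have E (e' : {ffun 'I_n -> bool}) (u : 'I_n -> nat -> R) :
    (forall i, i != i0 -> e' i = e i) -> (forall i, i != i0 -> u i = s i) ->
    (fun t => h t + \sum_i sgn_of (e' i) * u i t) =
    (fun t => rest t + sgn_of (e' i0) * u i0 t).
  move=> e'e us; apply/funext => t; rewrite (bigD1 i0)//= addrCA addrC; congr (_ + _ + _).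
  by apply: eq_bigr => i ii0; rewrite e'e// us.
have fle i : i != i0 -> fl e i = e i by rewrite ffunE => /negbTE ->.
rewrite !E//; try (by move=> i ii0; rewrite fle).
rewrite !ffunE eqxx ei0 /sgn_of/= expr1 expr0.
apply: esupD_le => x y; rewrite EFinD.
have [s0|s0] := leP 0 (s i0 y).
  apply: leeD; last by rewrite s'i0 ger0_norm//; exact: esup_ge.
  apply: (le_trans _ (esup_ge _ x)).
  by rewrite lee_fin s'i0 !mulN1r lerD2l lerN2 ler_norm.
rewrite [leRHS]addeC; apply: leeD; last first.
  apply: (le_trans _ (esup_ge _ y)).
  by rewrite lee_fin s'i0 ltr0_norm// mul1r mulN1r.
apply: (le_trans _ (esup_ge _ x)).
by rewrite lee_fin s'i0 mul1r mulN1r lerD2l lerNl -normrN ler_norm.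
Qed.

(** The sum over sign vectors is [2^n] times a Rademacher average; [h] leaves room for the penalty.
    The absolute values are treated one row at a time, [u r] being the stage at which the rows in
    [r] carry them. *)
Lemma contraction n (h : nat -> R) (s : 'I_n -> nat -> R) :
  (\sum_(e : {ffun 'I_n -> bool}) esup (fun t => h t + \sum_i sgn_of (e i) * `|s i t|)%R <=
   \sum_(e : {ffun 'I_n -> bool}) esup (fun t => h t + \sum_i sgn_of (e i) * s i t)%R)%E.
Proof.
pose u (r : seq 'I_n) (i : 'I_n) t := if i \in r then `|s i t| else s i t.
suff H r : (\sum_(e : {ffun 'I_n -> bool}) esup (fun t => h t + \sum_i sgn_of (e i) * u r i t)%R <=
   \sum_(e : {ffun 'I_n -> bool}) esup (fun t => h t + \sum_i sgn_of (e i) * s i t)%R)%E.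
  apply: le_trans (H (enum 'I_n)); apply: lee_sum => e _.
  by rewrite /u; under [X in (_ <= esup X)%E]eq_fun do under eq_bigr do rewrite mem_enum.
elim: r => [|i0 r IH]; first by apply: lee_sum => e _.
apply: le_trans IH; apply: (@contraction_step _ _ _ _ i0) => [i ii0|t].
  by rewrite /u; apply/funext => t; rewrite inE (negbTE ii0).
by rewrite /u inE eqxx/=; case: ifP; rewrite ?normr_id.
Qed.

End contraction.

(** * Penalized symmetrization with a ghost copy *)

Section symmetrization.
Context {R : realType} d (T : measurableType d)
  (P : probability T R) (mu : set R -> \bar R) (n : nat)
  (X : 'I_n * nat -> T -> R) (v q : R).
Hypothesis iX : iid P mu X.
Hypothesis mu_sym :
  forall B : set R, measurable B -> mu ((fun x : R => - x) @^-1` B) = mu B.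
Hypothesis EX2 : forall i, mean P (fun w => X i w ^+ 2) = v%:E.
Variables (y : nat -> nat -> R) (m : nat -> nat) (pen : nat -> R) (B0 : R)
  (b : nat -> R) (bsum : R).
Hypothesis y0 : forall j, y 0%N j = 0.
Hypothesis pen0 : pen 0%N = 0.
Hypothesis pen_ge0 : forall t, 0 <= pen t.
Hypothesis B0_ge0 : 0 <= B0.
Hypothesis b_ge0 : forall j, 0 <= b j.
Hypothesis b_sum : (\sum_(0 <= j <oo) (b j)%:E <= bsum%:E)%E.
(** Apart from [pen t], the right side depends on [t] only through the truncation [m t]. With [h]
    the signed column sums it therefore bounds a whole penalized supremum, by a series whose mean is
    explicit. *)
Hypothesis yb : forall t (h : nat -> R),
  \sum_(0 <= j < m t) h j * y t j <=
  pen t + (B0 + \sum_(0 <= j < m t) b j * h j ^+ 2).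

Definition row_sum (i : 'I_n) (t : nat) (z : 'I_n * nat -> R) : R :=
  \sum_(0 <= j < m t) y t j * z (i, j).

Let Z : bool * ('I_n * nat) -> T * T -> R :=
  fun bi w => X bi.2 (if bi.1 then w.2 else w.1).

Let G (zz : bool * ('I_n * nat) -> R) (t : nat) : R :=
  \sum_i (`|row_sum i t (fun ij => zz (true, ij))| -
    `|row_sum i t (fun ij => zz (false, ij))|) - 2 * pen t.

Let F (zz : bool * ('I_n * nat) -> R) : \bar R := esup (G zz).

Let mG t : measurable_fun setT (fun zz : array R (bool * ('I_n * nat))%type => G zz t).
Proof.
by rewrite /G /row_sum; measurable_tac.
Qed.

Let mF : measurable_fun setT (F : array R (bool * ('I_n * nat))%type -> \bar R).
Proof.
have -> : (F : array R (bool * ('I_n * nat))%type -> \bar R) =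
    (fun zz => esups (fun t => (G zz t)%:E) 0%N).
  apply/funext => zz; rewrite /F /esup /esups /sdrop /=; congr ereal_sup.
  by apply/seteqP; split => [_ [t _ <-]|_ [t _ <-]]; exists t.
apply: measurable_fun_esups => t; exact/measurable_EFinP.
Qed.

(** The family contains the origin with zero penalty. Nonnegativity is what Tonelli's theorem and
    the comparison of laws require. *)
Let F_ge0 zz : (0 <= F zz)%E.
Proof.
apply: (le_trans _ (esup_ge _ 0%N)); rewrite lee_fin /G pen0 mulr0 subr0.
rewrite big1// => i _.
have r0 z : row_sum i 0 z = 0 by rewrite /row_sum big1// => j _; rewrite y0 mul0r.
by rewrite !r0 subrr.
Qed.

Let iZ : iid (P \x P)%E mu Z. Proof. exact: iid_ghost. Qed.

Let mX ij : measurable_fun setT (X ij). Proof. exact: (proj1 iX). Qed.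

Let H (e : {ffun 'I_n -> bool}) (j : nat) (w : T) : R :=
  \sum_i sgn_of (e i) * X (i, j) w.

Let Bd (e : {ffun 'I_n -> bool}) (w : T) : \bar R :=
  (B0%:E + \sum_(0 <= j <oo) (b j * H e j w ^+ 2)%:E)%E.

Let mH e j : measurable_fun setT (H e j). Proof. rewrite /H; measurable_tac. Qed.

Let Bd_ge0 e w : (0 <= Bd e w)%E.
Proof.
apply: adde_ge0 => //; apply: nneseries_ge0 => j _ _.
by rewrite lee_fin mulr_ge0// sqr_ge0.
Qed.

Let mBd e : measurable_fun setT (Bd e).
Proof.
apply: emeasurable_funD => //; apply: ge0_emeasurable_sum => [j w _ _|j _].
  by rewrite lee_fin mulr_ge0// sqr_ge0.
by apply/measurable_EFinP; measurable_tac.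
Qed.

Let EH e j : mean P (fun w => H e j w ^+ 2) = (v * n%:R)%:E.
Proof.
have u : uniq [seq (i, j) | i <- index_enum 'I_n].
  by rewrite map_inj_uniq ?index_enum_uniq// => i1 i2 [].
have := mean_lin_sqr iX mu_sym EX2 (fun ij => sgn_of (e ij.1)) u.
rewrite big_map/=; under eq_mean do rewrite big_map/=.
move=> ->; congr (v * _)%:E; under eq_bigr do rewrite /sgn_of sqrr_sign.
by rewrite sumr_const card_ord.
Qed.

Let EBd e : (\int[P]_w Bd e w <= (B0 + v * n%:R * bsum)%:E)%E.
Proof.
rewrite ge0_integralD//; last 2 first.
- by move=> w _; apply: nneseries_ge0 => j _ _; rewrite lee_fin mulr_ge0// sqr_ge0.
- apply: ge0_emeasurable_sum => [j w _ _|j _].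
    by rewrite lee_fin mulr_ge0// sqr_ge0.
  by apply/measurable_EFinP; measurable_tac.
rewrite integral_nneseries//; last 2 first.
- by move=> j; apply/measurable_EFinP; measurable_tac.
- by move=> j w _; rewrite lee_fin mulr_ge0// sqr_ge0.
rewrite -/(mean P (fun=> B0)) mean_cst EFinD leeD2l//.
have v0 : 0 <= v * n%:R.
  by rewrite -lee_fin -(EH [ffun=> false] 0); apply: mean_ge0 => w; exact: sqr_ge0.
rewrite EFinM; apply: (@le_trans _ _ ((v * n%:R)%:E * \sum_(0 <= j <oo) (b j)%:E)%E).
  rewrite -nneseriesZl//; last by move=> j _; rewrite lee_fin.
  apply: lee_nneseries => [j _ _|j _].
    by apply: integral_ge0 => w _; rewrite lee_fin mulr_ge0// sqr_ge0.
  rewrite -/(mean P (fun w => b j * H e j w ^+ 2)%R) meanZ//; last 2 first.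
  - by measurable_tac.
  - by move=> w; exact: sqr_ge0.
  by rewrite EH muleC.
by rewrite lee_wpmul2l// lee_fin.
Qed.

Let V (e : {ffun 'I_n -> bool}) (w : T) : \bar R :=
  esup (fun t => - pen t + \sum_i sgn_of (e i) * `|row_sum i t (X^~ w)|).

(** Contraction compares only sums over all sign vectors, hence the sums on both sides. Exchanging
    rows and columns then turns the signed row sums into [\sum_j H e j w * y t j], to which [yb]
    applies. *)
Let V_le w : (\sum_(e : {ffun 'I_n -> bool}) V e w <=
  \sum_(e : {ffun 'I_n -> bool}) Bd e w)%E.
Proof.
apply: (le_trans (contraction _ _)); apply: lee_sum => e _.
apply: esup_le => t; rewrite /Bd.
apply: (@le_trans _ _ (B0 + \sum_(0 <= j < m t) b j * H e j w ^+ 2)%:E).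
  rewrite lee_fin -lerBrDl opprK addrC.
  apply: le_trans (yb t (H e ^~ w)); rewrite /H /row_sum.
  under eq_bigr do rewrite mulr_sumr.
  rewrite exchange_big/=; apply: ler_sum => j _.
  rewrite mulr_suml; apply: ler_sum => i _; by rewrite mulrA mulrAC.
rewrite EFinD leeD2l// -sumEFin; apply: nneseries_lim_ge => j _ _.
by rewrite lee_fin mulr_ge0// sqr_ge0.
Qed.

(** Row [i] trades places with its ghost exactly when [e i] holds; the joint law does not change,
    while the difference of the two absolute row sums changes sign. *)
Let swap (e : {ffun 'I_n -> bool}) (bi : bool * ('I_n * nat)) :=
  (bi.1 (+) e bi.2.1, bi.2).

Let swapK e : involutive (swap e).
Proof. by move=> [c [i j]]; rewrite /swap/= -addbA addbb addbF. Qed.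

Let EF_swap e : (\int[(P \x P)%E]_w F (Z^~ w) = \int[(P \x P)%E]_w F (fun bi => Z (swap e bi) w))%E.
Proof.
exact: (iid_law (F := F) iZ (iid_reindex (@swapK e) iZ) mF F_ge0).
Qed.

(** The two copies receive opposite signs, and the term [2 * pen t] in [G] splits into one penalty
    for each. The supremum of the sum is at most the sum of the two suprema. *)
Let F_swap_le e w : (F (fun bi => Z (swap e bi) w) <= V e w.2 + V [ffun i => ~~ e i] w.1)%E.
Proof.
apply: esup_le => t.
apply: (@le_trans _ _ ((- pen t + \sum_i sgn_of (e i) * `|row_sum i t (X^~ w.2)|)%:E
  + (- pen t + \sum_i sgn_of ([ffun i => ~~ e i] i) * `|row_sum i t (X^~ w.1)|)%:E)%E);
  last by apply: leeD; exact: esup_ge.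
rewrite -EFinD lee_fin /G addrACA -big_split/= addrC lerD//; last by lra.
apply: ler_sum => i _; rewrite ffunE /row_sum /Z /swap /=.
by case: (e i) => /=; rewrite /sgn_of/= ?expr0 ?expr1 ?mul1r ?mulN1r// addrC.
Qed.

Let EF_le : (\int[(P \x P)%E]_w F (Z^~ w) <= (2 * (B0 + v * n%:R * bsum))%:E)%E.
Proof.
have mZ : measurable_fun setT (fun w => F (Z^~ w)).
  apply: (@measurableT_comp _ _ _ _ _ _ (F : array R _ -> \bar R) _ (fun w => (Z^~ w : array R _))) => //.
  by apply: measurable_array; exact: (proj1 iZ).
have mZs e : measurable_fun setT (fun w => F (fun bi => Z (swap e bi) w)).
  apply: (@measurableT_comp _ _ _ _ _ _ (F : array R _ -> \bar R) _ (fun w => ((fun bi => Z (swap e bi) w) : array R _))) => //.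
  by apply: measurable_array => bi; exact: (proj1 iZ).
set c := (B0 + _).
set x := (\int[(P \x P)%E]_w F (Z^~ w))%E.
have x0 : (0 <= x)%E by apply: integral_ge0 => w _; exact: F_ge0.
(* Since [V_le] holds only after summation over [e], the bound is proved [2^n] times and
   cancelled. *)
suff : (\sum_(e : {ffun 'I_n -> bool}) x <= (\sum_(e : {ffun 'I_n -> bool}) (2 * c))%:E)%E.
  case: x x0 => [x| |]// _.
    by rewrite sumEFin !lee_fin !sumr_const lerMn2r card_ffun card_bool expn_eq0.
  rewrite (bigD1 [ffun=> false])//= addye ?leye_eq//.
  by rewrite gt_eqF// (lt_le_trans ltNy0)// sume_ge0.
rewrite (eq_bigr (fun e => \int[(P \x P)%E]_w F (fun bi => Z (swap e bi) w))%E);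
  last by move=> e _; exact: EF_swap.
rewrite -(@ge0_integral_sum _ _ _ (P \x P)%E _ measurableT _ _ mZs (fun e w _ => F_ge0 _)).
apply: (@le_trans _ _ (\int[(P \x P)%E]_w
    (\sum_(e : {ffun 'I_n -> bool}) Bd e w.2 + \sum_(e : {ffun 'I_n -> bool}) Bd e w.1))%E).
  apply: ge0_le_integral => //.
  - by move=> w _; apply: sume_ge0 => e _; exact: F_ge0.
  - exact: emeasurable_sum.
  - by apply: emeasurable_funD; apply: emeasurable_sum => e;
      exact: measurableT_comp.
  move=> w _.
  apply: (@le_trans _ _ (\sum_(e : {ffun 'I_n -> bool}) (V e w.2 + V [ffun i => ~~ e i] w.1))%E).
    by apply: lee_sum => e _; exact: F_swap_le.
  rewrite big_split/=; apply: leeD; first exact: V_le.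
  (* Negating all signs permutes the sign vectors, so the second copy obeys the same bound. *)
  have nK : involutive (fun e : {ffun 'I_n -> bool} => [ffun i => ~~ e i]).
    by move=> e; apply/ffunP => i; rewrite !ffunE negbK.
  rewrite (reindex_inj (inv_inj nK))/=; under eq_bigr do rewrite nK.
  exact: V_le.
have mB2 : measurable_fun setT (fun w : T * T => \sum_(e : {ffun 'I_n -> bool}) Bd e w.2)%E.
  by apply: emeasurable_sum => e; exact: measurableT_comp.
have mB1 : measurable_fun setT (fun w : T * T => \sum_(e : {ffun 'I_n -> bool}) Bd e w.1)%E.
  by apply: emeasurable_sum => e; exact: measurableT_comp.
have sB0 w : (0 <= \sum_(e : {ffun 'I_n -> bool}) Bd e w)%E.
  by apply: sume_ge0.
rewrite ge0_integralD//.
have EB : (\int[P]_w (\sum_(e : {ffun 'I_n -> bool}) Bd e w) <=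
    (\sum_(e : {ffun 'I_n -> bool}) c)%:E)%E.
  by rewrite ge0_integral_sum// -sumEFin; apply: lee_sum => e _; exact: EBd.
have -> : \sum_(e : {ffun 'I_n -> bool}) 2 * c =
    \sum_(e : {ffun 'I_n -> bool}) c + \sum_(e : {ffun 'I_n -> bool}) c.
  by rewrite -big_split/=; apply: eq_bigr => e _; rewrite mulr2n mulrDl mul1r.
rewrite EFinD; apply: leeD.
- rewrite (@fubini_tonelli1 _ _ _ _ _ P P)//= /fubini_F/=.
  by rewrite integral_cst// [X in (_ * X)%E]probability_setT mule1.
- rewrite (@fubini_tonelli1 _ _ _ _ _ P P)//= /fubini_F/=.
  under eq_integral do rewrite integral_cst// [X in (_ * X)%E]probability_setT mule1.
  exact: EB.
Qed.

(* [U w] is the average over a ghost copy [w'] of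
   [sup_t (\sum_i (|S_i(w')| - |S_i(w)|) - 2 pen t)]; this supremum is taken over a
   countable family so as to be measurable. *)
Lemma symmetrization : exists U : T -> \bar R,
  [/\ measurable_fun setT U, forall w, (0 <= U w)%E,
      (\int[P]_w U w <= (2 * (B0 + v * n%:R * bsum))%:E)%E &
      forall w t, (\sum_i mean P (fun w' => `|row_sum i t (X^~ w')|)%R <=
        U w + (\sum_i `|row_sum i t (X^~ w)| + 2 * pen t)%:E)%E].
Proof.
have mZ : measurable_fun setT (fun w => F (Z^~ w)).
  apply: (@measurableT_comp _ _ _ _ _ _ (F : array R _ -> \bar R) _ (fun w => (Z^~ w : array R _))) => //.
  by apply: measurable_array; exact: (proj1 iZ).
have FZ0 w : (0 <= F (Z^~ w))%E by exact: F_ge0.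
exists (fun w => \int[P]_w' F (Z^~ (w, w')))%E; split.
- have := @measurable_fun_fubini_tonelli_F _ _ _ _ _ P _ mZ FZ0; exact.
- by move=> w; apply: integral_ge0.
- by have := EF_le; rewrite (@fubini_tonelli1 _ _ _ _ _ P P).
move=> w t.
have mr i : measurable_fun setT (fun w' => `|row_sum i t (X^~ w')|).
  by apply: measurableT_comp => //; rewrite /row_sum; measurable_tac.
rewrite -mean_sum//.
set c := (X in (_ + X%:E)%E).
have c0 : 0 <= c.
  by rewrite addr_ge0 ?mulr_ge0// sumr_ge0.
have mFw : measurable_fun setT (fun w' => F (Z^~ (w, w'))).
  by apply: (measurableT_comp mZ); exact: measurable_pair1.
rewrite -(mean_cst P c) /mean -ge0_integralD//.
apply: ge0_le_integral => //.
- by move=> w' _; rewrite lee_fin sumr_ge0.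
- by apply/measurable_EFinP; apply: measurable_sum.
- exact: emeasurable_funD.
move=> w' _; rewrite -leeBlDr//; apply: le_trans (esup_ge _ t).
by rewrite -EFinB lee_fin /G /c /Z /= sumrB opprD addrA.
Qed.

End symmetrization.

(** * The Gaussian law *)

Section gaussian.
Context {R : realType}.

Lemma normal_prob_sym (B : set R) : measurable B ->
  normal_prob 0 1 ((fun x : R => - x) @^-1` B) = normal_prob 0 1 B :> \bar R.
Proof.
move=> mB; rewrite /normal_prob.
transitivity (\int[pushforward (@lebesgue_measure R)
    (-%R : _ -> measurableTypeR R)%R]_(x in B) (normal_pdf 0 1 x)%:E)%E; last first.
  by apply: eq_measure_integral => A mA _; exact: lebesgue_measureN.
rewrite ge0_integral_pushforward//; last 2 first.
- by apply/measurable_EFinP; apply: measurable_funTS; exact: measurable_normal_pdf.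
- by move=> x _; rewrite lee_fin normal_pdf_ge0.
apply: eq_integral => x _ /=; congr (_%:E).
by rewrite /normal_pdf oner_eq0 /normal_fun !subr0 sqrrN.
Qed.

(** The Radon-Nikodym derivative is determined almost everywhere by its integrals, hence equals the
    density. *)
Lemma integral_normal_prob (f : R -> R) : measurable_fun setT f ->
  (forall x, 0 <= f x) ->
  (\int[normal_prob 0 1]_x (f x)%:E =
   \int[lebesgue_measure]_x (f x * normal_pdf 0 1 x)%:E)%E.
Proof.
move=> mf f0.
have dom := normal_prob_dominates (0 : R) (1 : R).
have mpdf : measurable_fun setT (fun x : R => normal_pdf 0 1 x) by exact: measurable_normal_pdf.
rewrite -(Radon_Nikodym_SigmaFinite.change_of_variables dom)//; last exact/measurable_EFinP.
have ig := Radon_Nikodym_SigmaFinite.f_integrable dom.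
apply: ae_eq_integral => //.
- by apply: emeasurable_funM; [exact/measurable_EFinP|exact: measurable_int ig].
- by apply/measurable_EFinP; exact: measurable_funM.
have : ae_eq lebesgue_measure setT
    (Radon_Nikodym_SigmaFinite.f (normal_prob (0 : R) (1 : R)) lebesgue_measure)
    (fun x => (normal_pdf 0 1 x)%:E).
  apply: integral_ae_eq => //; first exact/measurable_EFinP.
  by move=> A _ mA; rewrite -Radon_Nikodym_SigmaFinite.f_integral.
apply: filterS => x /= h _; by rewrite h// EFinM.
Qed.

(** Domination by a multiple of the density of standard deviation 2. The exponents differ by
    [y = 3 x^2 / 8], and [x^4 = 256/9 * (y/2)^2 <= 64 * expR y]. *)
Lemma normal_moment4 : (\int[normal_prob 0 1]_x (x ^+ 4)%:E < +oo :> \bar R)%E.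
Proof.
rewrite integral_normal_prob; [|exact: exprn_measurable|by move=> x; rewrite exprn_even_ge0].
pose C : R := 64 * normal_peak 1 / normal_peak 2.
have pk1 : 0 < normal_peak (1 : R) by apply: normal_peak_gt0; exact: oner_neq0.
have pk2 : 0 < normal_peak (2 : R) by apply: normal_peak_gt0; rewrite pnatr_eq0.
have C0 : 0 <= C by rewrite /C divr_ge0// ?ltW// mulr_gt0.
apply: (@le_lt_trans _ _ (\int[lebesgue_measure]_x (C%:E * (normal_pdf 0 2 x)%:E))%E); last first.
  rewrite ge0_integralZl_EFin//; last 2 first.
  - by move=> x _; rewrite lee_fin normal_pdf_ge0.
  - by apply/measurable_EFinP; exact: measurable_normal_pdf.
  by rewrite integral_normal_pdf mule1 ltry.
apply: ge0_le_integral => //.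
- by move=> x _; rewrite lee_fin mulr_ge0 ?exprn_even_ge0// normal_pdf_ge0.
- apply/measurable_EFinP; apply: measurable_funM; first exact: exprn_measurable.
  exact: measurable_normal_pdf.
- apply/measurable_EFinP; apply: measurable_funM => //; exact: measurable_normal_pdf.
move=> x _; rewrite -EFinM lee_fin.
rewrite !normal_pdfE ?oner_eq0 ?pnatr_eq0//.
have -> : C * (normal_peak 2 * normal_fun 0 2 x) =
    normal_peak 1 * (64 * normal_fun 0 2 x).
  by rewrite /C; field; rewrite gt_eqF.
rewrite [leLHS]mulrCA ler_pM2l// /normal_fun !subr0.
have -> : - x ^+ 2 / (1 ^+ 2 *+ 2) = - x ^+ 2 / (2 ^+ 2 *+ 2) - 3 * x ^+ 2 / 8 :> R.
  by rewrite expr1n; field.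
rewrite expRD [leLHS]mulrCA [leRHS]mulrC ler_wpM2l ?expR_ge0//.
rewrite expRN ler_pdivrMr ?expR_gt0//.
set y := 3 * x ^+ 2 / 8.
have y0 : 0 <= y by rewrite /y divr_ge0// mulr_ge0// sqr_ge0.
have h : (y / 2) ^+ 2 <= expR y.
  have -> : y = y / 2 + y / 2 by field.
  rewrite expRD -expr2 -{1}[y / 2 + y / 2](_ : y = _); last by field.
  rewrite ler_sqr ?nnegrE ?expR_ge0//; last by apply: divr_ge0.
  by apply: le_trans (expR_ge1Dx _); rewrite lerDr.
have -> : x ^+ 4 = 256 / 9 * (y / 2) ^+ 2 by rewrite /y; field.
have := expR_ge0 y; lra.
Qed.


(** A vanishing second moment would concentrate the law at [0], which is a null set by absolute
    continuity. *)
Lemma normal_moment2_gt0 : (0 < \int[normal_prob 0 1]_x (x ^+ 2)%:E :> \bar R)%E.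
Proof.
rewrite lt_neqAle integral_ge0 ?andbT; last by move=> x _; rewrite lee_fin sqr_ge0.
apply/eqP => /esym h.
have m2 : measurable_fun setT (fun x : R => (x ^+ 2)%:E).
  by apply/measurable_EFinP; exact: exprn_measurable.
have : (\int[normal_prob 0 1]_x `|(x ^+ 2)%:E| = 0 :> \bar R)%E.
  rewrite -h; apply: eq_integral => x _.
  by rewrite gee0_abs// lee_fin sqr_ge0.
move=> h2; case: (proj1 (ae_eq_integral_abs (normal_prob (0 : R) 1) measurableT m2) h2) => N [mN N0 hN].
have : normal_prob 0 1 ([set~ 0] : set R) = 0%E :> \bar R.
  apply/eqP; rewrite -measure_le0 -N0 le_measure ?inE//; first exact: measurableC.
  move=> x x0; apply: hN => /= /(_ I) /eqP; rewrite eqe sqrf_eq0 => /eqP.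
  exact: x0.
have : normal_prob 0 1 ([set 0] : set R) = 0%E :> \bar R.
  have /null_content_dominatesP dom := normal_prob_dominates (0 : R) (1 : R).
  by apply: dom => //; exact: lebesgue_measure_set1.
move=> h0 h1; have := probability_setT (normal_prob (0 : R) 1).
rewrite -(setUv [set 0 : R]) measureU//=; last 2 first.
- exact: measurableC.
- by rewrite setICr.
by rewrite h0 h1 adde0 => /eqP; rewrite eq_sym onee_eq0.
Qed.


Lemma gaussian_matrix_iid d (T : measurableType d) (P : probability T R) (n : nat)
    (g : 'I_n -> nat -> {RV P >-> R}) : gaussian_matrix g ->
  iid P (normal_prob 0 1) (fun ij w => g ij.1 ij.2 w).
Proof.
move=> [gg ig]; split=> [ij|s B us mB]; first exact: measurable_funPT.
rewrite (ig s B us mB); apply: eq_bigr => ij _.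
by rewrite -(gg ij.1 ij.2).
Qed.

Lemma gaussian_mean d (T : measurableType d) (P : probability T R)
    (X : {RV P >-> R}) (f : R -> R) : standard_gaussian X ->
  measurable_fun setT f -> (forall x, 0 <= f x) ->
  mean P (fun w => f (X w)) = (\int[normal_prob 0 1]_x (f x)%:E)%E.
Proof.
move=> gX mf f0; rewrite /mean.
have mX : measurable_fun setT (X : T -> measurableTypeR R).
  exact: (measurable_funPT X).
pose Y : {mfun T >-> measurableTypeR R} := HB.pack (X : T -> measurableTypeR R)
  (isMeasurableFun.Build _ _ _ _ _ mX).
have mf' : measurable_fun setT (fun x : measurableTypeR R => (f x)%:E).
  exact: (proj2 (measurable_EFinP setT f) mf).
have := @ge0_integral_distribution _ _ _ _ _ P Y _ mf'.
move=> <-; last by move=> x; rewrite lee_fin.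
by apply: eq_measure_integral => A mA _; exact: gX.
Qed.

Lemma gaussian_matrix_moment d (T : measurableType d) (P : probability T R)
    (n : nat) (g : 'I_n -> nat -> {RV P >-> R}) (k : nat) (c : R) :
  gaussian_matrix g -> (\int[normal_prob 0 1]_x (x ^+ k)%:E)%E = c%:E ->
  ~~ odd k ->
  forall ij, mean P (fun w => g ij.1 ij.2 w ^+ k) = c%:E.
Proof.
move=> gg <- k2 ij; apply: (gaussian_mean (f := fun x => x ^+ k)) => [||x].
- exact: gg.1.
- exact: exprn_measurable.
- by rewrite exprn_even_ge0.
Qed.

Lemma gaussian_moments : exists v q : R, [/\ 0 < v,
  (\int[normal_prob 0 1]_x (x ^+ 2)%:E)%E = v%:E &
  (\int[normal_prob 0 1]_x (x ^+ 4)%:E)%E = q%:E].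
Proof.
have q0 : (0 <= \int[normal_prob (0 : R) 1]_x (x ^+ 4)%:E)%E.
  by apply: integral_ge0 => x _; rewrite lee_fin exprn_even_ge0.
have v0 := normal_moment2_gt0.
(* Finiteness of the second moment comes from that of the fourth, through [x^2 <= 1 + x^4]. *)
have vq : (\int[normal_prob (0 : R) 1]_x (x ^+ 2)%:E <=
    1 + \int[normal_prob (0 : R) 1]_x (x ^+ 4)%:E)%E.
  have m4 : measurable_fun setT (fun x : measurableTypeR R => x ^+ 4).
    exact: (@exprn_measurable R setT 4).
  have m2 : measurable_fun setT (fun x : measurableTypeR R => x ^+ 2).
    exact: (@exprn_measurable R setT 2).
  have p4 (x : R) : 0 <= x ^+ 4 by rewrite exprn_even_ge0.
  have := meanD (normal_prob (0 : R) 1) (measurable_cst (1 : R)) m4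
    (fun=> ler01) p4.
  rewrite mean_cst /mean => <-.
  apply: mean_le; [exact: m2| |by move=> x; exact: sqr_ge0|].
    exact: (measurable_funD (measurable_cst (1 : R)) m4).
  move=> x; have h (t : R) : t <= 1 + t ^+ 2 by nra.
  by rewrite (exprM x 2 2); exact: h.
have qE := fineK (eq_trans (ge0_fin_numE q0) normal_moment4).
exists (fine (\int[normal_prob (0 : R) 1]_x (x ^+ 2)%:E)%E).
exists (fine (\int[normal_prob (0 : R) 1]_x (x ^+ 4)%:E)%E).
have v' : (\int[normal_prob (0 : R) 1]_x (x ^+ 2)%:E)%E \is a fin_num.
  by rewrite ge0_fin_numE ?(ltW v0)// (le_lt_trans vq)// -qE -EFinD ltry.
split; [|by rewrite fineK|by rewrite qE].
by rewrite -lte_fin fineK.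
Qed.

End gaussian.

(** * The ellipsoid and the radius of information *)

Section square_summable.
Context {R : realType}.

Lemma nneseries_le (f : nat -> R) (M : R) : (forall j, 0 <= f j) ->
  (forall m, \sum_(0 <= j < m) f j <= M) ->
  (\sum_(0 <= j <oo) (f j)%:E <= M%:E)%E.
Proof.
move=> f0 fM; apply: lime_le.
  by apply: is_cvg_nneseries => j _ _; rewrite lee_fin.
by apply: nearW => m; rewrite sumEFin lee_fin.
Qed.

Lemma nneseries_psum (f : nat -> R) (M : R) m : (forall j, 0 <= f j) ->
  (\sum_(0 <= j <oo) (f j)%:E <= M%:E)%E -> \sum_(0 <= j < m) f j <= M.
Proof.
move=> f0 fM; rewrite -lee_fin -sumEFin; apply: le_trans fM.
by apply: nneseries_lim_ge => j _ _; rewrite lee_fin.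
Qed.

Lemma ell2_normE (x : nat -> R) :
  ell2_norm x = ((\sum_(0 <= j <oo) (x j ^+ 2)%:E) `^ 2^-1)%E.
Proof.
rewrite /ell2_norm Lnorm_counting//; congr (_ `^ _)%E.
apply: eq_eseriesr => j _ /=.
rewrite powR_mulrn// -normrX ger0_norm//.
exact: sqr_ge0.
Qed.

Lemma ell2_norm_le (x : nat -> R) (M : R) : 0 <= M ->
  (forall m, \sum_(0 <= j < m) x j ^+ 2 <= M ^+ 2) -> (ell2_norm x <= M%:E)%E.
Proof.
move=> M0 xM; rewrite ell2_normE.
have -> : M%:E = ((M ^+ 2)%:E `^ 2^-1)%E.
  by rewrite poweR_EFin powR12_sqrt ?sqr_ge0// sqrtr_sqr ger0_norm.
have x2 : (0 <= \sum_(0 <= j <oo) (x j ^+ 2)%:E)%E.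
  by apply: nneseries_ge0 => j _ _; rewrite lee_fin sqr_ge0.
apply: gt0_ler_poweR => //; rewrite ?in_itv/= ?x2 ?leey ?lee_fin ?sqr_ge0//.
by apply: nneseries_le => // j; exact: sqr_ge0.
Qed.

Lemma ell2_norm_ge (x : nat -> R) j : (`|x j|%:E <= ell2_norm x)%E.
Proof.
rewrite ell2_normE.
have -> : `|x j|%:E = ((x j ^+ 2)%:E `^ 2^-1)%E.
  by rewrite poweR_EFin powR12_sqrt ?sqr_ge0// sqrtr_sqr.
have x2 : (0 <= \sum_(0 <= j <oo) (x j ^+ 2)%:E)%E.
  by apply: nneseries_ge0 => i _ _; rewrite lee_fin sqr_ge0.
apply: gt0_ler_poweR => //; rewrite ?in_itv/= ?x2 ?leey ?lee_fin ?sqr_ge0//.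
apply: (@le_trans _ _ (\sum_(0 <= i < j.+1) (x i ^+ 2)%:E)%E).
  by rewrite big_nat_recr//= leeDr// sume_ge0// => i _; rewrite lee_fin sqr_ge0.
by apply: nneseries_lim_ge => i _ _; rewrite lee_fin sqr_ge0.
Qed.

Lemma ell2P (x : nat -> R) :
  ell2 x <-> exists M, forall m, \sum_(0 <= j < m) x j ^+ 2 <= M.
Proof.
have x2 : (0 <= \sum_(0 <= j <oo) (x j ^+ 2)%:E)%E.
  by apply: nneseries_ge0 => j _ _; rewrite lee_fin sqr_ge0.
split=> [|[M xM]].
  rewrite /ell2/= => /sub_Lfun_finLfun; rewrite inE/= /finite_norm.
  rewrite -[('N[_]_(_)[_])%E]/(ell2_norm x) ell2_normE.
  case E : (\sum_(0 <= j <oo) (x j ^+ 2)%:E)%E x2 => [r| |]// _.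
    by move=> _; exists r => m; apply: nneseries_psum; rewrite ?E// => j; exact: sqr_ge0.
  by rewrite /= invr_eq0 pnatr_eq0/= ltxx.
rewrite /ell2/= inE; apply/andP; split; rewrite inE//=.
rewrite /finite_norm -[('N[_]_(_)[_])%E]/(ell2_norm x).
have M0 : 0 <= M by have := xM 0%N; rewrite big_nil.
apply: (@le_lt_trans _ _ (Num.sqrt M)%:E); last exact: ltry.
by apply: ell2_norm_le; rewrite ?sqrtr_ge0// => m; rewrite sqr_sqrtr.
Qed.

End square_summable.

(** * The ellipsoid in terms of real partial sums *)

Section ellipsoid.
Context {R : realType} (sigma : nat -> R).
Hypothesis sigma_ge0 : forall j, 0 <= sigma j.
Hypothesis sigma_mono : nonincreasing_seq sigma.

(** For [sigma j = 0] the two conventions agree: [0 * +oo = 0] in [\bar R] and [0 / 0 = 0] in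
    [R]. *)
Lemma weighted_term (x : nat -> R) j : (sigma j = 0 -> x j = 0) ->
  (((x j)%:E / (sigma j)%:E) ^+ 2)%E = ((x j / sigma j) ^+ 2)%:E.
Proof.
move=> h; rewrite inver; case: eqVneq => [s0|s0].
  by rewrite h// s0 mul0e mul0r !expr2 mulr0 /expe/= mul0e.
by rewrite -EFinM -EFin_expe.
Qed.

Lemma weighted_term_ge0 (x : nat -> R) j :
  (0 <= ((x j)%:E / (sigma j)%:E) ^+ 2)%E.
Proof. by rewrite expe2 sqre_ge0. Qed.

Lemma sqr_le_weighted (x : nat -> R) j : (sigma j = 0 -> x j = 0) ->
  x j ^+ 2 <= sigma 0%N ^+ 2 * (x j / sigma j) ^+ 2.
Proof.
move=> s0; have [sj|sj] := eqVneq (sigma j) 0.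
  by rewrite s0// expr0n/= mulr_ge0// sqr_ge0.
rewrite -exprMn mulrCA exprMn ler_peMr ?sqr_ge0//.
rewrite exprn_ege1// ler_pdivlMr ?mul1r; first exact: sigma_mono.
by rewrite lt_neqAle eq_sym sj sigma_ge0.
Qed.

(** A nonzero coordinate over a zero semi-axis contributes [+oo], and elsewhere the quotients are
    real. Conversely [sigma <= sigma 0] makes membership in [ell2] automatic. *)
Lemma ellipsoidP (x : nat -> R) : ellipsoid sigma x <->
  (forall j, sigma j = 0 -> x j = 0) /\
  (forall m, \sum_(0 <= j < m) (x j / sigma j) ^+ 2 <= 1).
Proof.
split=> [[_ wx]|[s0 wx]].
  have s0 j : sigma j = 0 -> x j = 0.
    move=> sj; apply/eqP; apply: contraTT wx => xj; rewrite -ltNge.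
    apply: (@lt_le_trans _ _ (\sum_(0 <= i < j.+1) ((x i)%:E / (sigma i)%:E) ^+ 2)%E).
      rewrite big_nat_recr//= sj inver eqxx.
      have -> : ((x j)%:E * +oo * ((x j)%:E * +oo) = +oo)%E.
        by rewrite mulr_infty; case: sgrP xj => //; rewrite ?mul1e ?mulN1e.
      by rewrite addey ?ltry// gt_eqF// (lt_le_trans ltNy0)// sume_ge0// => i _; exact: weighted_term_ge0.
    by apply: nneseries_lim_ge => i _ _; exact: weighted_term_ge0.
  split=> // m; apply: nneseries_psum => [j|]; first exact: sqr_ge0.
  apply: le_trans wx; rewrite le_eqVlt; apply/orP; left; apply/eqP.
  by apply: eq_eseriesr => j _; rewrite weighted_term//; exact: s0.
split; last first.
  rewrite /weighted_sq (eq_eseriesr (g := fun j => ((x j / sigma j) ^+ 2)%:E)).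
    by apply: nneseries_le => // j; exact: sqr_ge0.
  by move=> j _; rewrite weighted_term//; exact: s0.
apply/ell2P; exists (sigma 0%N ^+ 2 * 1) => m.
apply: (@le_trans _ _ (sigma 0%N ^+ 2 * \sum_(0 <= j < m) (x j / sigma j) ^+ 2)); last first.
  by rewrite ler_wpM2l// sqr_ge0.
by rewrite mulr_sumr; apply: ler_sum => j _; apply: sqr_le_weighted; exact: s0.
Qed.

Lemma ellipsoid_psum (x : nat -> R) m : ellipsoid sigma x ->
  \sum_(0 <= j < m) x j ^+ 2 <= sigma 0%N ^+ 2.
Proof.
move=> /ellipsoidP[s0 wx]; rewrite -[leRHS]mulr1.
apply: (@le_trans _ _ (sigma 0%N ^+ 2 * \sum_(0 <= j < m) (x j / sigma j) ^+ 2)); last first.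
  by rewrite ler_wpM2l// sqr_ge0.
by rewrite mulr_sumr; apply: ler_sum => j _; apply: sqr_le_weighted; exact: s0.
Qed.

Lemma ellipsoid_abs (x : nat -> R) j : ellipsoid sigma x -> `|x j| <= sigma 0%N.
Proof.
move=> Ex; rewrite -(ger0_norm (sigma_ge0 0)) -ler_sqr ?nnegrE// !real_normK ?num_real//.
apply: le_trans (ellipsoid_psum j.+1 Ex).
by rewrite big_nat_recr//= lerDr sumr_ge0// => i _; exact: sqr_ge0.
Qed.

Lemma ellipsoid_ell2 (x : nat -> R) : ellipsoid sigma x -> ell2 x.
Proof. by case. Qed.

Lemma ellipsoid_le (x y : nat -> R) : ellipsoid sigma x ->
  (forall j, `|y j| <= `|x j|) -> ellipsoid sigma y.
Proof.
move=> /ellipsoidP[s0 wx] yx; apply/ellipsoidP; split=> [j /s0 xj|m].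
  by apply/eqP; rewrite -normr_le0 -(normr0 R) -xj.
apply: le_trans (wx m); apply: ler_sum => j _; rewrite !exprMn ler_wpM2r ?sqr_ge0//.
rewrite -(real_normK (num_real (x j))) -(real_normK (num_real (y j))).
by rewrite ler_sqr ?nnegrE.
Qed.

Lemma ellipsoid0 : ellipsoid sigma (fun=> 0).
Proof.
by apply/ellipsoidP; split => // m; rewrite big1// => j _; rewrite mul0r expr0n.
Qed.

Lemma ellipsoid_half_diff (x y : nat -> R) : ellipsoid sigma x -> ellipsoid sigma y ->
  ellipsoid sigma (fun j => (x j - y j) / 2).
Proof.
move=> /ellipsoidP[x0 wx] /ellipsoidP[y0 wy]; apply/ellipsoidP; split=> [j sj|m].
  by rewrite x0// y0// subr0 mul0r.
apply: (@le_trans _ _ (2^-1 * (\sum_(0 <= j < m) (x j / sigma j) ^+ 2 +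
    \sum_(0 <= j < m) (y j / sigma j) ^+ 2))).
  rewrite -big_split mulr_sumr; apply: ler_sum => j _ /=.
  rewrite mulrAC mulrBl; move: (x j / _) (y j / _) => a c.
  by have := sqr_ge0 (a + c); rewrite !expr2; lra.
by have := wx m; have := wy m; lra.
Qed.

End ellipsoid.

(** * The radius and the kernel of the information *)

Section radius.
Context {R : realType} (sigma : nat -> R).
Hypothesis sigma_ge0 : forall j, 0 <= sigma j.
Hypothesis sigma_mono : nonincreasing_seq sigma.
Context {n : nat} (A : 'I_n -> nat -> R).

Lemma radius_le (phi : ('I_n -> option R) -> (nat -> R)) (M : \bar R) :
  (forall r, ell2 (phi r)) ->
  (forall x, ellipsoid sigma x -> (ell2_norm (phi (info A x) \- x)%R <= M)%E) ->
  (radius sigma A <= M)%E.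
Proof.
move=> phi2 phiM; apply: (@le_trans _ _
  (ereal_sup [set ell2_norm (phi (info A x) \- x) | x in ellipsoid sigma])).
  by apply: ereal_inf_lbound; exists phi => // r _; exact: phi2.
by apply: ge_ereal_sup => _ [x Ex <-]; exact: phiM.
Qed.

Lemma radius_ge (M : \bar R) :
  (forall phi : ('I_n -> option R) -> (nat -> R),
    exists2 x, ellipsoid sigma x & (M <= ell2_norm (phi (info A x) \- x)%R)%E) ->
  (M <= radius sigma A)%E.
Proof.
move=> h; apply: le_ereal_inf_tmp => _ [phi _ <-].
have [x Ex Mx] := h phi; apply: le_trans Mx _.
by apply: ereal_sup_ubound; exists x.
Qed.

Lemma radius_ge0 : (0 <= radius sigma A)%E.
Proof.
apply: radius_ge => phi; exists (fun=> 0); first exact: ellipsoid0.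
by rewrite /ell2_norm Lnorm_ge0.
Qed.

Lemma ell2_0 : @ell2 R (fun=> 0).
Proof. by apply/ell2P; exists 0 => m; rewrite big1// => j _; rewrite expr0n. Qed.

Lemma radius_le_sigma0 : (radius sigma A <= (sigma 0%N)%:E)%E.
Proof.
apply: (@radius_le (fun=> fun=> 0)) => [_|x Ex]; first exact: ell2_0.
apply: ell2_norm_le => // m; under eq_bigr do rewrite /= sub0r sqrrN.
exact: (ellipsoid_psum sigma_ge0 sigma_mono).
Qed.

(** Both [x] and [- x] produce zero information, and any common value of [phi] is at distance at
    least [|x 0|] from one of them, already in the first coordinate. Finite support makes the
    partial sums eventually constant. *)
Lemma radius_ge_kernel (x : nat -> R) (m : nat) : ellipsoid sigma x ->
  (forall j, (m <= j)%N -> x j = 0) ->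
  (forall i, \sum_(0 <= j < m) A i j * x j = 0) ->
  (`|x 0%N|%:E <= radius sigma A)%E.
Proof.
move=> Ex xm Ax.
have i0 (y : nat -> R) : (forall j, (m <= j)%N -> y j = 0) ->
    (forall i, \sum_(0 <= j < m) A i j * y j = 0) -> info A y = (fun=> Some 0).
  move=> ym Ay; apply/funext => i; rewrite /info.
  have c0 : series (fun j => A i j * y j) @ \oo --> (0 : R).
    apply: cvg_near_cst; exists m => // k /= mk; rewrite /series/=.
    rewrite (big_cat_nat (leq0n _) mk)//= Ay add0r big_nat big1// => j /andP[mj _].
    by rewrite ym// mulr0.
  rewrite asboolT; last by apply/cvg_ex; exists 0.
  by congr Some; apply/cvg_lim.
apply: radius_ge => phi.
pose z := phi (fun=> Some 0) 0%N.
have [h|h] : (`|x 0%N| <= `|z - x 0%N| \/ `|x 0%N| <= `|z - - x 0%N|).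
  have : `|x 0%N| *+ 2 <= `|z - x 0%N| + `|z - - x 0%N|.
    have -> : `|x 0%N| *+ 2 = `|(z - - x 0%N) - (z - x 0%N)|.
      by rewrite -normrMn; congr (`|_|); ring.
    by rewrite [leRHS]addrC; exact: ler_normB.
  by case: (leP `|x 0%N| `|z - x 0%N|) => h1; [left|right; lra].
- exists x => //; rewrite i0//.
  by apply: le_trans (ell2_norm_ge _ 0%N); rewrite lee_fin.
- exists (fun j => - x j).
    by apply: (ellipsoid_le sigma_ge0 sigma_mono Ex) => j; rewrite normrN.
  rewrite i0.
  + by apply: le_trans (ell2_norm_ge _ 0%N); rewrite lee_fin.
  + by move=> j mj; rewrite xm// oppr0.
  + move=> i; under eq_bigr do rewrite mulrN.
    by rewrite sumrN Ax oppr0.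
Qed.

Definition summable_rows := forall i, exists M, forall m,
  \sum_(0 <= j < m) (sigma j * A i j) ^+ 2 <= M.

(** On such matrices [info] never returns [None] on the ellipsoid, so equal information means equal
    limits. The series converges absolutely, by [|a b| <= (a^2 + b^2) / 2]. *)
Lemma cvg_row (x : nat -> R) i : summable_rows -> ellipsoid sigma x ->
  cvgn (series (fun j => A i j * x j)).
Proof.
move=> /(_ i)[M hM] Ex; have /(ellipsoidP sigma_ge0 sigma_mono)[s0 wx] := Ex.
apply: normed_cvg; apply: nondecreasing_is_cvgn.
  move=> a b ab /=; rewrite /series/= (big_cat_nat (leq0n _) ab)//= lerDl.
  by apply: sumr_ge0 => j _; exact: normr_ge0.
exists (2^-1 * (M + 1)) => _ [m _ <-]; rewrite /series/=.
apply: (@le_trans _ _ (\sum_(0 <= j < m) 2^-1 * ((sigma j * A i j) ^+ 2 + (x j / sigma j) ^+ 2))).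
  apply: ler_sum => j _.
  have -> : A i j * x j = (sigma j * A i j) * (x j / sigma j).
    have [sj|sj] := eqVneq (sigma j) 0; first by rewrite s0// mul0r !mulr0.
    by field.
  move: (sigma j * _) (x j / _) => a b.
  rewrite normrM -(real_normK (num_real a)) -(real_normK (num_real b)).
  by have := sqr_ge0 (`|a| - `|b|); lra.
rewrite -mulr_sumr ler_pM2l// big_split/=.
by have := hM m; have := wx m; lra.
Qed.

(** [phi] returns some point of the ellipsoid with the observed information. Half its difference
    from the true point lies in the ellipsoid and in the kernel, whence the factor 2. *)
Lemma radius_le_kernel (D : R) : summable_rows -> 0 <= D ->
  (forall x, ellipsoid sigma x ->
    (forall i, series (fun j => A i j * x j) @ \oo --> (0 : R)) ->
    forall m, \sum_(0 <= j < m) x j ^+ 2 <= D ^+ 2) ->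
  (radius sigma A <= (2 * D)%:E)%E.
Proof.
move=> gA D0 kD.
pose phi (r : 'I_n -> option R) : nat -> R :=
  if pselect (exists2 x, ellipsoid sigma x & info A x = r) is left h
  then sval (cid2 h) else fun=> 0.
apply: (@radius_le phi) => [r|x Ex].
  rewrite /phi; case: pselect => [h|_]; last exact: ell2_0.
  by case: cid2 => /= y Ey _; exact: ellipsoid_ell2 Ey.
rewrite /phi; case: pselect => [h|]; last by case; exists x.
case: cid2 => /= y Ey yx.
apply: ell2_norm_le => [|m]; first by rewrite mulr_ge0.
have -> : \sum_(0 <= j < m) (y \- x) j ^+ 2 = 4 * \sum_(0 <= j < m) ((y j - x j) / 2) ^+ 2.
  by rewrite mulr_sumr; apply: eq_bigr => j _ /=; field.
rewrite exprMn (_ : 2 ^+ 2 = 4); last by ring.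
rewrite ler_pM2l//; apply: kD; first exact: ellipsoid_half_diff.
move=> i; have cx := @cvg_row _ i gA Ex; have cy := @cvg_row _ i gA Ey.
have := congr1 (fun f => f i) yx; rewrite /info !asboolT// => -[lim_eq].
have -> : series (fun j => A i j * ((y j - x j) / 2)) =
   (fun k => (series (fun j => A i j * y j) k - series (fun j => A i j * x j) k) / 2).
  apply/funext => k; rewrite /series/= -sumrB mulr_suml; apply: eq_bigr => j _.
  by ring.
rewrite -[X in _ --> X](mul0r 2^-1) -(subrr (limn (series (fun j => A i j * x j)))).
by apply: cvgMl; apply: cvgB => //; rewrite -lim_eq.
Qed.

End radius.

(** * Countable approximation of the ellipsoid *)

Section approximation.
Context {R : realType} (sigma : nat -> R).
Hypothesis sigma_ge0 : forall j, 0 <= sigma j.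
Hypothesis sigma_mono : nonincreasing_seq sigma.

(* Rounding towards zero, so as to stay in the ellipsoid. *)
Lemma round_to_zero (x : R) (N : nat) : exists z : int,
  `|z%:~R / N.+1%:R| <= `|x| /\ `|x - z%:~R / N.+1%:R| <= N.+1%:R^-1.
Proof.
have N0 : 0 < N.+1%:R :> R by [].
wlog x0 : x / 0 <= x.
  move=> h; have [/h//|x0] := leP 0 x.
  have [|z [z1 z2]] := h (- x); first by lra.
  exists (- z); rewrite mulrNz mulNr normrN -[`|x|]normrN; split => //.
  by rewrite opprK -normrN opprD.
have xN : 0 <= x * N.+1%:R by rewrite mulr_ge0.
have /andP[k1 k2] := truncn_itv xN.
exists (Posz (Num.truncn (x * N.+1%:R))); rewrite -pmulrn.
set k := (Num.truncn _)%:R in k1 *.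
have {}k2 : x * N.+1%:R < k + 1 by rewrite natr1.
have k3 : k / N.+1%:R <= x by rewrite ler_pdivrMr.
split; first by rewrite !ger0_norm// divr_ge0.
rewrite ger0_norm ?subr_ge0// lerBlDr.
have -> : N.+1%:R^-1 + k / N.+1%:R = (k + 1) / N.+1%:R by rewrite mulrDl mul1r addrC.
by rewrite ler_pdivlMr// ltW.
Qed.

(** Index [0] is reserved for the origin; [t.+1] decodes a length, integer numerators and a common
    denominator, and codes leaving the ellipsoid give the origin. The weights [K] are arbitrary
    because they will depend on the outcome. *)
Lemma dense_family : exists (y : nat -> nat -> R) (m : nat -> nat),
  [/\ forall j, y 0%N j = 0, forall t, ellipsoid sigma (y t) &
    forall (x K : nat -> R) (M : nat) (eta : R), ellipsoid sigma x ->
      (forall j, 0 <= K j) -> 0 < eta ->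
      exists2 t, m t = M & \sum_(0 <= j < M) K j * `|x j - y t j| <= eta].
Proof.
pose w (u : nat * seq int * nat) (j : nat) : R :=
  if (j < u.1.1)%N then (nth 0 u.1.2 j)%:~R / u.2.+1%:R else 0.
pose ok u := `[< ellipsoid sigma (w u) >].
exists (fun t => if t is t'.+1 then
   if unpickle t' is Some u then if ok u then w u else fun=> 0 else fun=> 0
   else fun=> 0).
exists (fun t => if t is t'.+1 then
   if unpickle t' is Some u then (u : nat * seq int * nat).1.1 else 0%N else 0%N).
split=> [//|[|t]|x K M eta Ex K0 eta0].
- exact: ellipsoid0.
- case: unpickle => [u|]; last exact: ellipsoid0.
  case: ifPn => [|_]; last exact: ellipsoid0.
  by move/asboolP.
pose N := Num.truncn ((\sum_(0 <= j < M) K j) / eta).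
have [z hz] := choice (fun j => round_to_zero (x j) N).
pose u := (M, mkseq z M, N).
have wE j : (j < M)%N -> w u j = (z j)%:~R / N.+1%:R.
  by move=> jM; rewrite /w/= jM nth_mkseq.
have Ew : ellipsoid sigma (w u).
  apply: (ellipsoid_le sigma_ge0 sigma_mono Ex) => j; have [jM|jM] := ltnP j M.
    by rewrite wE//; exact: (hz j).1.
  by rewrite /w/= ltnNge jM/= normr0.
exists (pickle u).+1; rewrite pickleK//.
rewrite /ok asboolT//.
apply: (@le_trans _ _ (\sum_(0 <= j < M) K j * N.+1%:R^-1)).
  rewrite big_nat [leRHS]big_nat; apply: ler_sum => j /andP[_ jM].
  by rewrite wE// ler_wpM2l//; exact: (hz j).2.
rewrite -mulr_suml ler_pdivrMr// mulrC -ler_pdivrMr//.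
have S0 : 0 <= (\sum_(0 <= j < M) K j) / eta.
  by rewrite divr_ge0 ?(ltW eta0)// sumr_ge0.
by have /andP[_ /ltW] := truncn_itv S0.
Qed.

End approximation.

(** * Square summable semi-axes *)

(* The radius is not known to be measurable, so that its integral is a lower
   integral. *)
Lemma le_integral_nonmeas {R : realType} d (T : measurableType d)
    (mu : {measure set T -> \bar R}) (f g : T -> \bar R) :
  (forall x, 0 <= f x)%E -> (forall x, f x <= g x)%E ->
  (\int[mu]_x f x <= \int[mu]_x g x)%E.
Proof.
move=> f0 fg; have g0 x : (0 <= g x)%E by apply: le_trans (fg x).
rewrite !ge0_integralTE//; apply: ge_ereal_sup => _ [h hf <-].
by apply: ereal_sup_ubound; exists h => // x; apply: le_trans (fg x).
Qed.

Section tails.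
Context {R : realType}.

Lemma psum_indicator (a : R) k m :
  \sum_(0 <= j < m) (if (j < k)%N then a else 0) = a * (minn m k)%:R.
Proof.
elim: m => [|m IH]; first by rewrite big_nil min0n mulr0.
rewrite big_nat_recr//= IH; have [mk|mk] := ltnP m k.
  by rewrite (minn_idPl mk) -natr1 mulrDr mulr1.
by rewrite (minn_idPr (leqW mk)) addr0.
Qed.

Lemma psum_tail (a : nat -> R) k m :
  \sum_(0 <= j < m) (if (j < k)%N then 0 else a j) =
  \sum_(0 <= j < m) a j - \sum_(0 <= j < minn m k) a j.
Proof.
elim: m => [|m IH]; first by rewrite min0n !big_nil subrr.
rewrite !(big_nat_recr m)//= IH; have [mk|mk] := ltnP m k.
  rewrite (minn_idPl mk) big_nat_recr//=; ring.
by rewrite (minn_idPr (leqW mk)); ring.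
Qed.

Lemma small_tail (a : nat -> R) (M e : R) : (forall j, 0 <= a j) ->
  (forall m, \sum_(0 <= j < m) a j <= M) -> 0 < e ->
  exists2 k, (0 < k)%N &
    forall m, \sum_(0 <= j < m) (if (j < k)%N then 0 else a j) <= e.
Proof.
move=> a0 aM e0; pose S := series a.
have nS : nondecreasing_seq S.
  move=> i j ij; rewrite /S /series/= (big_cat_nat (leq0n _) ij)//= lerDl.
  exact: sumr_ge0.
have cS : cvgn S.
  by apply: nondecreasing_is_cvgn => //; exists M => _ [m _ <-]; exact: aM.
have /cvgrPdist_le /(_ e e0) [k _ hk] := cS.
(* The cut-off is shifted to be positive, since the penalty weight divides by it. *)
exists k.+1 => // m; rewrite psum_tail.
have [mk|mk] := leqP m k.+1; first by rewrite subrr ltW.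
have := hk k.+1 (leqnSn k); rewrite ger0_norm ?subr_ge0; last exact: nondecreasing_cvgn_le.
apply: le_trans; rewrite lerB//; first exact: (nondecreasing_cvgn_le nS cS m).
Qed.

End tails.

(** * The mean radius for a fixed number of rows *)

Section upper_bound.
Context {R : realType} (sigma : nat -> R).
Hypothesis sigma_ge0 : forall j, 0 <= sigma j.
Hypothesis sigma_mono : nonincreasing_seq sigma.
Context d (T : measurableType d) (P : probability T R) (mu : set R -> \bar R)
  (n : nat) (X : 'I_n * nat -> T -> R) (v q : R).
Hypothesis n_gt0 : (0 < n)%N.
Hypothesis iX : iid P mu X.
Hypothesis mu_sym :
  forall B : set R, measurable B -> mu ((fun x : R => - x) @^-1` B) = mu B.
Hypothesis v_gt0 : 0 < v.
Hypothesis EX2 : forall i, mean P (fun w => X i w ^+ 2) = v%:E.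
Hypothesis EX4 : forall i, mean P (fun w => X i w ^+ 4) = q%:E.
Variables (k : nat) (tail eta s2 : R).
Hypothesis k_gt0 : (0 < k)%N.
Hypothesis eta_gt0 : 0 < eta.
Hypothesis tailP : forall m,
  \sum_(0 <= j < m) (if (j < k)%N then 0 else sigma j ^+ 2) <= tail.
Hypothesis s2P : forall m, \sum_(0 <= j < m) sigma j ^+ 2 <= s2.

Let c := abs_const v q.
Let c_gt0 : 0 < c. Proof. exact: abs_const_gt0. Qed.

Let nR_gt0 : 0 < n%:R :> R. Proof. by rewrite ltr0n. Qed.
Let kR_gt0 : 0 < k%:R :> R. Proof. by rewrite ltr0n. Qed.

Let bet : R := n%:R * c / (4 * k%:R).
Let bet_gt0 : 0 < bet.
Proof. by rewrite /bet divr_gt0// mulr_gt0. Qed.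

(* [tau] balances [\sum_(j >= k) h_j x_j <= tau / 2 + \sum_(j >= k) (sigma_j h_j)^2 / (2 tau)]
   on the ellipsoid. *)
Let tau : R := Num.sqrt n%:R * eta.
Let tau_gt0 : 0 < tau. Proof. by rewrite /tau mulr_gt0// sqrtr_gt0. Qed.

(** What AM-GM leaves in front of [h_j^2]. For [j < k] it reads
    [|h y| <= bet |y| + |y| / (4 bet) * h^2], combined with [|y| <= sigma 0]. *)
Let b (j : nat) : R :=
  if (j < k)%N then sigma 0%N / (4 * bet) else sigma j ^+ 2 / (2 * tau).

Let b_ge0 j : 0 <= b j.
Proof. by rewrite /b; case: ifP => _; rewrite divr_ge0 ?sqr_ge0// mulr_ge0// ltW. Qed.

Let bsum : R := sigma 0%N / (4 * bet) * k%:R + tail / (2 * tau).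

Let b_sum : (\sum_(0 <= j <oo) (b j)%:E <= bsum%:E)%E.
Proof.
apply: nneseries_le => // m.
have -> : \sum_(0 <= j < m) b j =
    \sum_(0 <= j < m) (if (j < k)%N then sigma 0%N / (4 * bet) else 0) +
    (\sum_(0 <= j < m) (if (j < k)%N then 0 else sigma j ^+ 2)) / (2 * tau).
  rewrite mulr_suml -big_split; apply: eq_bigr => j _ /=; rewrite /b.
  by case: ifP => _; rewrite ?mul0r ?addr0 ?add0r.
apply: lerD.
  rewrite psum_indicator ler_wpM2l ?ler_nat ?geq_minr//.
  by rewrite divr_ge0// mulr_ge0// ltW.
by rewrite ler_wpM2r// invr_ge0 mulr_ge0// ltW.
Qed.

Let penalty (m : nat) (y : nat -> R) : R :=
  bet * \sum_(0 <= j < m) (if (j < k)%N then `|y j| else 0).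

Let penalty_ge0 m y : 0 <= penalty m y.
Proof. by rewrite mulr_ge0 ?(ltW bet_gt0)// sumr_ge0// => j _; case: ifP. Qed.

Let penalized (m : nat) (y h : nat -> R) : ellipsoid sigma y ->
  \sum_(0 <= j < m) h j * y j <=
  penalty m y + (tau / 2 + \sum_(0 <= j < m) b j * h j ^+ 2).
Proof.
move=> Ey; have /(ellipsoidP sigma_ge0 sigma_mono)[s0 wy] := Ey.
apply: (@le_trans _ _ (penalty m y + (tau / 2 * \sum_(0 <= j < m) (y j / sigma j) ^+ 2
    + \sum_(0 <= j < m) b j * h j ^+ 2))); last first.
  by rewrite lerD2l lerD2r ler_piMr// divr_ge0// ltW.
rewrite /penalty !mulr_sumr -!big_split; apply: ler_sum => j _ /=; rewrite /b.
case: ifP => jk.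
  have yj := ellipsoid_abs sigma_ge0 sigma_mono j Ey.
  have h1 : h j * y j <= bet * `|y j| + `|y j| / (4 * bet) * h j ^+ 2.
    apply: (le_trans (ler_norm _)); rewrite normrM.
    rewrite -(real_normK (num_real (h j))).
    have : 0 <= `|y j| / (4 * bet) * (2 * bet - `|h j|) ^+ 2.
      by rewrite mulr_ge0 ?sqr_ge0// divr_ge0// mulr_ge0// ltW.
    have -> : `|y j| / (4 * bet) * (2 * bet - `|h j|) ^+ 2 =
      bet * `|y j| + `|y j| / (4 * bet) * `|h j| ^+ 2 - `|h j| * `|y j|.
      by field; rewrite gt_eqF.
    by rewrite subr_ge0.
  apply: (le_trans h1); rewrite lerD2l.
  have : `|y j| / (4 * bet) * h j ^+ 2 <= sigma 0%N / (4 * bet) * h j ^+ 2.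
    by rewrite ler_wpM2r ?sqr_ge0// ler_wpM2r// invr_ge0 mulr_ge0// ltW.
  have : 0 <= tau / 2 * (y j / sigma j) ^+ 2.
    by rewrite mulr_ge0 ?sqr_ge0// divr_ge0// ltW.
  by lra.
rewrite mulr0 add0r.
have -> : h j * y j = (h j * sigma j) * (y j / sigma j).
  have [sj|sj] := eqVneq (sigma j) 0; first by rewrite s0// mul0r !mulr0.
  by field.
have -> : sigma j ^+ 2 / (2 * tau) * h j ^+ 2 = (h j * sigma j) ^+ 2 / (2 * tau).
  by rewrite exprMn; ring.
move: (h j * _) (y j / _) => a e; rewrite -subr_ge0.
have -> : tau / 2 * e ^+ 2 + a ^+ 2 / (2 * tau) - a * e = (tau * e - a) ^+ 2 / (2 * tau).
  by field; rewrite gt_eqF.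
by rewrite divr_ge0 ?sqr_ge0// mulr_ge0// ltW.
Qed.

(** Each of the at most [k] penalized coordinates is bounded by the norm. The 4 in [bet] lets two
    penalties consume only half of [n c |y|]. *)
Let penalty_le m y : penalty m y <=
  n%:R * c / 4 * Num.sqrt (\sum_(0 <= j < m) y j ^+ 2).
Proof.
set Y := \sum_(0 <= j < m) _.
apply: (@le_trans _ _ (bet * (Num.sqrt Y * k%:R))); last first.
  rewrite /bet le_eqVlt; apply/orP; left; apply/eqP; field.
  by rewrite pnatr_eq0 -lt0n.
rewrite ler_wpM2l ?(ltW bet_gt0)//.
apply: (@le_trans _ _ (\sum_(0 <= j < m) (if (j < k)%N then Num.sqrt Y else 0))).
  rewrite big_nat [leRHS]big_nat; apply: ler_sum => j /andP[_ jm]; case: ifP => // _.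
  rewrite -sqrtr_sqr ler_sqrt; last by apply: sumr_ge0 => i _; exact: sqr_ge0.
  rewrite /Y (big_cat_nat (leq0n _) (ltnW jm))//= (big_ltn jm)/=.
  have s_ge0 p r : 0 <= \sum_(p <= i < r) y i ^+ 2.
    by apply: sumr_ge0 => i _; exact: sqr_ge0.
  by have := s_ge0 0%N j; have := s_ge0 j.+1 m; lra.
by rewrite psum_indicator ler_wpM2l ?sqrtr_ge0// ler_nat geq_minr.
Qed.

Let mX ij : measurable_fun setT (X ij). Proof. exact: (proj1 iX). Qed.

(* [W w < +oo] makes all the series of [info] converge; adding an arbitrarily small
   multiple of [W] to the bound disposes of the other [w]. *)
Let W (w : T) : \bar R :=
  (\sum_(i < n) \sum_(0 <= j <oo) ((sigma j * X (i, j) w) ^+ 2)%:E)%E.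

Let W_ge0 w : (0 <= W w)%E.
Proof.
apply: sume_ge0 => i _; apply: nneseries_ge0 => j _ _.
by rewrite lee_fin sqr_ge0.
Qed.

Let mW : measurable_fun setT W.
Proof.
apply: emeasurable_sum => i; apply: ge0_emeasurable_sum => [j w _ _|j _].
  by rewrite lee_fin sqr_ge0.
by apply/measurable_EFinP; measurable_tac.
Qed.

Let EW : (\int[P]_w W w <= (n%:R * (v * s2))%:E)%E.
Proof.
have mi i : measurable_fun setT (fun w => \sum_(0 <= j <oo) ((sigma j * X (i, j) w) ^+ 2)%:E)%E.
  apply: ge0_emeasurable_sum => [j w _ _|j _]; first by rewrite lee_fin sqr_ge0.
  by apply/measurable_EFinP; measurable_tac.
rewrite ge0_integral_sum//; last first.
  move=> i w _; apply: nneseries_ge0 => j _ _; by rewrite lee_fin sqr_ge0.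
apply: (@le_trans _ _ (\sum_(i < n) (v * s2)%:E)%E); last first.
  by rewrite sumEFin sumr_const card_ord mulr_natl.
apply: lee_sum => i _; rewrite integral_nneseries//; last 2 first.
- by move=> j; apply/measurable_EFinP; measurable_tac.
- by move=> j w _; rewrite lee_fin sqr_ge0.
rewrite (eq_eseriesr (g := fun j => (v * sigma j ^+ 2)%:E)).
  apply: nneseries_le => [j|m]; first by rewrite mulr_ge0 ?sqr_ge0// ltW.
  by rewrite -mulr_sumr ler_wpM2l// ltW.
move=> j _; rewrite -/(mean P (fun w => (sigma j * X (i, j) w) ^+ 2)%R).
under eq_mean do rewrite exprMn.
rewrite meanZ ?sqr_ge0//; [|by measurable_tac|by move=> w; exact: sqr_ge0].
by rewrite EX2 -EFinM mulrC.
Qed.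

Let summable w : (W w < +oo)%E -> summable_rows sigma (fun i j => X (i, j) w).
Proof.
move=> Wf i.
have Wi : (\sum_(0 <= j <oo) ((sigma j * X (i, j) w) ^+ 2)%:E <= W w)%E.
  rewrite /W (bigD1 i)//= leeDl// sume_ge0// => l _.
  by apply: nneseries_ge0 => j _ _; rewrite lee_fin sqr_ge0.
have := le_lt_trans Wi Wf.
have : (0 <= \sum_(0 <= j <oo) ((sigma j * X (i, j) w) ^+ 2)%:E)%E.
  by apply: nneseries_ge0 => j _ _; rewrite lee_fin sqr_ge0.
case E : (\sum_(0 <= j <oo) _)%E => [r| |]// _ _.
exists r => m; apply: nneseries_psum; rewrite ?E// => j; exact: sqr_ge0.
Qed.

(** A point [y t] close to [x] has almost vanishing row sums, so the hypothesis leaves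
    [n c |y t| <= u + n c / 2 * |y t|] up to small errors. *)
Lemma kernel_le (y : nat -> nat -> R) (m : nat -> nat)
    (y_dense : forall (x K : nat -> R) (M : nat) (eta : R), ellipsoid sigma x ->
      (forall j, 0 <= K j) -> 0 < eta ->
      exists2 t, m t = M & \sum_(0 <= j < M) K j * `|x j - y t j| <= eta)
    (y_ell : forall t, ellipsoid sigma (y t)) (w : T) (u : R) :
  (forall t, \sum_(i < n) mean P (fun w' => `|row_sum y m i t (X^~ w')|)%R <=
     (u + (\sum_i `|row_sum y m i t (X^~ w)| + 2 * penalty (m t) (y t)))%:E)%E ->
  forall x, ellipsoid sigma x ->
  (forall i, series (fun j => X (i, j) w * x j) @ \oo --> (0 : R)) ->
  forall M, n%:R * c / 2 * Num.sqrt (\sum_(0 <= j < M) x j ^+ 2) <= u.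
Proof.
move=> hu x Ex x0 M; apply/ler_addgt0Pr => e e0.
(* The [n] row sums cost [n e'] and the norm costs [n c / 2 * e'], together [e]. *)
pose e' := e / (n%:R + n%:R * c / 2).
have D0 : 0 < n%:R + n%:R * c / 2 by rewrite addr_gt0// divr_gt0// mulr_gt0.
have e'0 : 0 < e' by rewrite divr_gt0.
have eE : e = n%:R * e' + n%:R * c / 2 * e' by rewrite -mulrDl mulrC divfK// gt_eqF.
have e2 : 0 < e' / 2 by rewrite divr_gt0.
have hN i : exists N, forall p, (N <= p)%N -> `|\sum_(0 <= j < p) X (i, j) w * x j| <= e' / 2.
  have /cvgrPdist_le /(_ _ e2) [N _ hN] := x0 i.
  by exists N => p Np; have := hN p Np; rewrite sub0r normrN.
have [N {}hN] := choice hN.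
(* Long enough for the partial norm and for all truncated rows of [x] to be small. *)
pose M' := maxn M (\max_i N i).
have S0 : 0 <= sigma 0%N by [].
(* These weights dominate both the entries of each row and the factor [|x_j + y_j| <= 2 * sigma 0]
   of a difference of squares. Of the two tolerances below, [e' / 2] serves the rows and [e' ^+ 2]
   the norm, by [sqrt (Y + e'^2) <= sqrt Y + e']. *)
pose K j := \sum_i `|X (i, j) w| + 2 * sigma 0%N.
have K0 j : 0 <= K j by rewrite addr_ge0 ?mulr_ge0// sumr_ge0.
have eta0 : 0 < Num.min (e' / 2) (e' ^+ 2) by rewrite lt_min e2 exprn_gt0.
have [t mt] := y_dense x K M' _ Ex K0 eta0.
rewrite le_min => /andP[K1 K2].
have row i : `|row_sum y m i t (X^~ w)| <= e'.
  rewrite /row_sum mt.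
  have -> : \sum_(0 <= j < M') y t j * X (i, j) w =
    \sum_(0 <= j < M') X (i, j) w * x j - \sum_(0 <= j < M') X (i, j) w * (x j - y t j).
    by rewrite -sumrB; apply: eq_bigr => j _; ring.
  apply: le_trans (ler_normB _ _) _.
  have -> : e' = e' / 2 + e' / 2 by field.
  apply: lerD; first by apply: hN; rewrite leq_max (leq_bigmax i) orbT.
  apply: le_trans K1; apply: le_trans (ler_norm_sum _ _ _) _.
  apply: ler_sum => j _; rewrite normrM ler_wpM2r// /K.
  rewrite (bigD1 i)//= -addrA lerDl addr_ge0 ?mulr_ge0// sumr_ge0//.
set Y := \sum_(0 <= j < M') y t j ^+ 2.
have Y0 : 0 <= Y by apply: sumr_ge0 => j _; exact: sqr_ge0.
have xY : Num.sqrt (\sum_(0 <= j < M) x j ^+ 2) <= Num.sqrt Y + e'.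
  have h0 : 0 <= Num.sqrt Y + e' by rewrite addr_ge0 ?sqrtr_ge0// ltW.
  rewrite -(ger0_norm h0) -sqrtr_sqr ler_sqrt ?sqr_ge0//.
  apply: (@le_trans _ _ (Y + e' ^+ 2)); last first.
    rewrite sqrrD sqr_sqrtr// -addrA lerD2l lerDr mulrn_wge0//.
    by rewrite mulr_ge0 ?sqrtr_ge0// ltW.
  apply: (@le_trans _ _ (\sum_(0 <= j < M') x j ^+ 2)).
    rewrite (@big_cat_nat _ _ _ M 0 M')//= ?leq_maxl// lerDl.
    by apply: sumr_ge0 => j _; exact: sqr_ge0.
  rewrite -lerBlDl -sumrB; apply: le_trans K2; apply: ler_sum => j _.
  rewrite subr_sqr mulrC; apply: (le_trans (ler_norm _)).
  rewrite normrM ler_wpM2r//; apply: le_trans (ler_normD _ _) _.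
  have := ellipsoid_abs sigma_ge0 sigma_mono j Ex.
  have := ellipsoid_abs sigma_ge0 sigma_mono j (y_ell t).
  have : 0 <= \sum_i `|X (i, j) w| by apply: sumr_ge0.
  by rewrite /K; lra.
have lowr : ((n%:R * (c * Num.sqrt Y))%:E <=
    \sum_(i < n) mean P (fun w' => `|row_sum y m i t (X^~ w')|)%R)%E.
  apply: (@le_trans _ _ (\sum_(i < n) (c * Num.sqrt Y)%:E)%E).
    by rewrite sumEFin sumr_const card_ord mulr_natl.
  apply: lee_sum => i _.
  have us : uniq [seq (i, j) | j <- index_iota 0 M'].
    by rewrite map_inj_uniq ?iota_uniq// => j1 j2 [].
  have := mean_abs_lin_ge iX mu_sym v_gt0 EX2 EX4 (fun ij => y t ij.2) us.
  rewrite big_map; under eq_mean do rewrite big_map.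
  by rewrite /row_sum mt.
have := le_trans lowr (hu t); rewrite lee_fin => h1.
have h2 : \sum_i `|row_sum y m i t (X^~ w)| <= n%:R * e'.
  apply: (@le_trans _ _ (\sum_(i < n) e')); first exact: ler_sum.
  by rewrite sumr_const card_ord mulr_natl.
have h3 := penalty_le (m t) (y t); rewrite mt -/Y in h3 h1.
have h4 : n%:R * c / 2 * Num.sqrt (\sum_(0 <= j < M) x j ^+ 2) <=
    n%:R * c / 2 * (Num.sqrt Y + e').
  by rewrite ler_wpM2l// divr_ge0// mulr_ge0// ltW.
by rewrite eE; lra.
Qed.

(** On the kernel [|x| <= 2 U / (n c)] by [kernel_le]; the factor 2 of [radius_le_kernel] gives
    [4 U / (n c)]. *)
Lemma mean_radius_le :
  (\int[P]_w radius sigma (fun i j => X (i, j) w) <=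
   (4 / (n%:R * c) * (2 * (tau / 2 + v * n%:R * bsum)))%:E)%E.
Proof.
have [y [m [y0 Ey y_dense]]] := dense_family sigma_ge0 sigma_mono.
pose pen t := penalty (m t) (y t).
have pen0 : pen 0%N = 0.
  rewrite /pen /penalty big1 ?mulr0// => j _; rewrite y0 normr0.
  by case: ifP.
have [U [mU U0 EU hU]] := symmetrization iX mu_sym EX2 y0 pen0
  (fun t => penalty_ge0 (m t) (y t)) (divr_ge0 (ltW tau_gt0) (ler0n _ 2)) b_ge0 b_sum
  (fun t h => penalized (m t) h (Ey t)).
have a0 : 0 < 4 / (n%:R * c) by rewrite divr_gt0// mulr_gt0.
apply/lee_addgt0Pr => e e0.
(* Makes [del] times the mean of [W] at most [e]; the [1] guards against a zero denominator. *)
pose del := e / (n%:R * (v * s2) + 1).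
have s20 : 0 <= s2 by have := s2P 0; rewrite big_nil.
have D0 : 0 < n%:R * (v * s2) + 1.
  by rewrite ltr_wpDl// mulr_ge0// mulr_ge0// ltW.
have del0 : 0 < del by rewrite divr_gt0.
apply: (@le_trans _ _ (\int[P]_w ((4 / (n%:R * c))%:E * U w + del%:E * W w))%E).
  apply: le_integral_nonmeas => w; first exact: radius_ge0.
  have [Wf|Wf] := ltP (W w) +oo%E; last first.
    rewrite leye_eq in Wf; rewrite (eqP Wf) gt0_muley ?lte_fin// addey ?leey//.
    by rewrite gt_eqF// (lt_le_trans ltNy0)// mule_ge0// lee_fin ltW.
  apply: (@le_trans _ _ ((4 / (n%:R * c))%:E * U w)%E); last first.
    by rewrite leeDl// mule_ge0// lee_fin ltW.
  move: (U0 w) (hU w); case: (U w) => [u| |]// u0 hu; last first.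
    by rewrite gt0_muley ?lte_fin// leey.
  rewrite -EFinM; pose D := 2 * u / (n%:R * c).
  have -> : 4 / (n%:R * c) * u = 2 * D by rewrite /D; ring.
  have u_ge0 : 0 <= u by rewrite -lee_fin.
  have nc_gt0 : 0 < n%:R * c by rewrite mulr_gt0.
  have D_ge0 : 0 <= D by rewrite divr_ge0 ?(ltW nc_gt0)// mulr_ge0.
  apply: radius_le_kernel => //; first exact: summable.
  move=> x Ex x0 M.
  have := kernel_le y_dense Ey (u := u) hu Ex x0 M.
  set S := \sum_(0 <= j < M) x j ^+ 2 => hS.
  have S0 : 0 <= S by apply: sumr_ge0 => j _; exact: sqr_ge0.
  rewrite -(sqr_sqrtr S0) ler_sqr ?nnegrE ?sqrtr_ge0//.
  rewrite /D ler_pdivlMr//.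
  have -> : Num.sqrt S * (n%:R * c) = 2 * (n%:R * c / 2 * Num.sqrt S) by field.
  by rewrite ler_pM2l.
rewrite ge0_integralD//; last 4 first.
- by move=> w _; rewrite mule_ge0// lee_fin ltW.
- by apply: measurable_funeM.
- by move=> w _; rewrite mule_ge0// lee_fin ltW.
- by apply: measurable_funeM.
rewrite !ge0_integralZl_EFin// ?(ltW del0) ?(ltW a0)//.
rewrite [X in (_ <= X + _)%E]EFinM; apply: leeD.
  by rewrite lee_wpmul2l// lee_fin ltW.
apply: (@le_trans _ _ (del * (n%:R * (v * s2)))%:E).
  by rewrite [leRHS]EFinM lee_wpmul2l// lee_fin ltW.
rewrite lee_fin /del mulrAC ler_pdivrMr// ler_wpM2l ?(ltW e0)//.
by rewrite lerDl.
Qed.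

End upper_bound.

Lemma cvge0_le {R : realType} (u : nat -> \bar R) : (forall n, 0 <= u n)%E ->
  (forall e : R, 0 < e -> \forall n \near \oo, (u n <= e%:E)%E) ->
  u @ \oo --> 0%E.
Proof.
move=> u0 ue; apply/fine_cvgP; split.
  have := ue 1 ltr01; apply: filterS => n un.
  by rewrite ge0_fin_numE// (le_lt_trans un)// ltry.
apply/cvgrPdist_le => e e0; have := ue e e0; apply: filterS => n un.
rewrite /= sub0r normrN ger0_norm ?fine_ge0// -lee_fin fineK//.
by rewrite ge0_fin_numE// (le_lt_trans un)// ltry.
Qed.

Section square_summable_radius.
Context (R : realType) (d : measure_display) (T : measurableType d)
  (P : probability T R) (g : forall n : nat, 'I_n -> nat -> {RV P >-> R}).
Hypothesis hg : forall n, gaussian_matrix (@g n).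
Variable sigma : nat -> R.
Hypothesis sigma_ge0 : forall j, 0 <= sigma j.
Hypothesis sigma_mono : nonincreasing_seq sigma.

Lemma radius_cvg0 : ell2 sigma ->
  ((fun n : nat => ((Num.sqrt (n%:R : R))%:E *
     \int[P]_w radius_random_info sigma (@g n) w)%E) @ \oo --> 0%E).
Proof.
move=> /ell2P[s2 s2P].
have [v [q [v0 vE qE]]] := @gaussian_moments R.
pose c := abs_const v q; have c0 : 0 < c by exact: abs_const_gt0.
apply: cvge0_le => [n|e e0].
  rewrite mule_ge0 ?lee_fin ?sqrtr_ge0//; apply: integral_ge0 => w _.
  exact: radius_ge0.
(* The bound splits into three terms, each to be at most [e / 3]: [eta] fixes the one from [tau],
   [tail] the one from the coordinates beyond [k], and [B <= sqrt n] controls the head term, of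
   order [k^2 / sqrt n]. *)
pose eta := e * c / 12.
have eta0 : 0 < eta by rewrite divr_gt0// mulr_gt0.
pose tail := e * c * eta / (12 * v).
have tail0 : 0 < tail by exact: divr_gt0 (mulr_gt0 (mulr_gt0 e0 c0) eta0) (mulr_gt0 (ltr0Sn _ 11) v0).
have [k k0 kP] := small_tail (fun j => sqr_ge0 (sigma j)) s2P tail0.
pose B := 24 * v * sigma 0%N * k%:R ^+ 2 / (c ^+ 2 * e).
have B0 : 0 <= B.
  have D0 : 0 < c ^+ 2 * e by rewrite mulr_gt0// exprn_gt0.
  apply: divr_ge0 (ltW D0); apply: mulr_ge0 (sqr_ge0 _).
  by apply: mulr_ge0 => //; apply: mulr_ge0 => //; exact: ltW.
exists (Num.truncn (B ^+ 2)).+1 => // n /= nB.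
have n0 : (0 < n)%N by apply: leq_trans nB.
pose r := Num.sqrt (n%:R : R).
have r0 : 0 < r by rewrite sqrtr_gt0 ltr0n.
have r2 : n%:R = r ^+ 2 by rewrite sqr_sqrtr.
have Br : B <= r.
  rewrite -(ger0_norm B0) -sqrtr_sqr ler_sqrt//.
  have /andP[_ /ltW h] := truncn_itv (sqr_ge0 B).
  by apply: (le_trans h); rewrite ler_nat.
have := mean_radius_le sigma_ge0 sigma_mono n0
  (gaussian_matrix_iid (hg n)) normal_prob_sym v0
  (gaussian_matrix_moment (hg n) vE isT) (gaussian_matrix_moment (hg n) qE isT) k0 eta0 kP s2P.
move=> /(lee_wpmul2l (x := r%:E)); rewrite lee_fin => /(_ (ltW r0)) h.
apply: (le_trans h); rewrite -EFinM lee_fin.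
rewrite -/r -/c r2.
have hr : r != 0 by rewrite gt_eqF.
have hc : c != 0 by rewrite gt_eqF.
have hk : k%:R != 0 :> R by rewrite pnatr_eq0 -lt0n.
have heta : eta != 0 by rewrite gt_eqF.
have hv : v != 0 by rewrite gt_eqF.
have he : e != 0 by rewrite gt_eqF.
have -> : r * (4 / (r ^+ 2 * c) * (2 * (r * eta / 2 + v * r ^+ 2 *
    (sigma 0%N / (4 * (r ^+ 2 * c / (4 * k%:R))) * k%:R + tail / (2 * (r * eta)))))) =
    4 / c * eta + 8 * v * sigma 0%N * k%:R ^+ 2 / (c ^+ 2 * r) + 4 / c * v * tail / eta.
  by field; rewrite hr hc hk heta.
have -> : 4 / c * eta = e / 3 by rewrite /eta; field; rewrite hc.
have -> : 4 / c * v * tail / eta = e / 3.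
  by rewrite /tail; field; rewrite hc hv heta.
have : 8 * v * sigma 0%N * k%:R ^+ 2 / (c ^+ 2 * r) <= e / 3.
  have cr : 0 < c ^+ 2 * r by apply: mulr_gt0 => //; exact: exprn_gt0.
  rewrite ler_pdivrMr//.
  have -> : 8 * v * sigma 0%N * k%:R ^+ 2 = B * (c ^+ 2 * e) / 3.
    by rewrite /B; field; rewrite hc he.
  have -> : e / 3 * (c ^+ 2 * r) = r * (c ^+ 2 * e) / 3 by field.
  by rewrite ler_pM2r ?invr_gt0// ler_pM2r//; apply: mulr_gt0 => //; exact: exprn_gt0.
move=> h3; apply: (@le_trans _ _ (e / 3 + e / 3 + e / 3)); last by lra.
by rewrite lerD2r lerD2l.
Qed.

End square_summable_radius.

(** * Semi-axes that are not square summable *)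

Section gram.
Context {R : realType} (sigma : nat -> R).
Hypothesis sigma_ge0 : forall j, 0 <= sigma j.
Hypothesis sigma_mono : nonincreasing_seq sigma.
Context {n : nat} (A : 'I_n -> nat -> R) (m : nat).

(** The matrix [B B^T], where [B] consists of the columns [1..m] of [A diag(sigma)]; column [0] is
    set apart as the one to be cancelled. *)
Definition gram (i k : 'I_n) : R :=
  \sum_(0 <= j < m) sigma j.+1 ^+ 2 * A k j.+1 * A i j.+1.

Variables (S : R).
Hypothesis S_gt0 : 0 < S.
Hypothesis n_gt0 : (0 < n)%N.
Hypothesis gram_near : forall i k, `|gram i k - S * (i == k)%:R| <= S / (2 * n%:R).

(** An error of [S / (2 n)] in each of the [n^2] entries costs at most [S / 2 * \sum_i u_i^2], by
    [|u_i u_k| <= (u_i^2 + u_k^2) / 2]. *)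
Lemma gram_quad_ge (u : 'I_n -> R) :
  S / 2 * \sum_i u i ^+ 2 <= \sum_i \sum_k u i * u k * gram i k.
Proof.
have nR : 0 < n%:R :> R by rewrite ltr0n.
have e0 : 0 <= S / (2 * n%:R) by rewrite divr_ge0 ?mulr_ge0// ltW.
have h i k : S * (i == k)%:R * (u i * u k) - S / (2 * n%:R) / 2 * (u i ^+ 2 + u k ^+ 2)
    <= u i * u k * gram i k.
  rewrite lerBlDr -lerBlDl.
  have -> : S * (i == k)%:R * (u i * u k) - u i * u k * gram i k =
     - (u i * u k * (gram i k - S * (i == k)%:R)) by ring.
  apply: (le_trans (ler_norm _)); rewrite normrN normrM mulrC.
  apply: (@le_trans _ _ (S / (2 * n%:R) * `|u i * u k|)); first by rewrite ler_wpM2r.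
  have -> : S / (2 * n%:R) / 2 * (u i ^+ 2 + u k ^+ 2) =
    S / (2 * n%:R) * ((u i ^+ 2 + u k ^+ 2) / 2) by ring.
  rewrite ler_wpM2l// normrM.
  rewrite -(real_normK (num_real (u i))) -(real_normK (num_real (u k))).
  have := sqr_ge0 (`|u i| - `|u k|).
  by rewrite sqrrB; lra.
apply: (@le_trans _ _ (\sum_i \sum_k (S * (i == k)%:R * (u i * u k) -
    S / (2 * n%:R) / 2 * (u i ^+ 2 + u k ^+ 2)))); last first.
  by apply: ler_sum => i _; apply: ler_sum => k _; exact: h.
have e1 : \sum_i \sum_k (u i ^+ 2 + u k ^+ 2) = (n%:R * \sum_i u i ^+ 2) *+ 2.
  under eq_bigr do rewrite big_split/= sumr_const card_ord.
  rewrite big_split/= sumrMnl sumr_const card_ord.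
  by rewrite -[(\sum_i u i ^+ 2) *+ n]mulr_natl mulr2n.
have -> : \sum_i \sum_k (S * (i == k)%:R * (u i * u k) -
    S / (2 * n%:R) / 2 * (u i ^+ 2 + u k ^+ 2)) =
    S * \sum_i u i ^+ 2 - S / (2 * n%:R) / 2 *
      ((n%:R * \sum_i u i ^+ 2) *+ 2).
  rewrite -e1 !mulr_sumr -sumrB; apply: eq_bigr => i _.
  rewrite sumrB mulr_sumr; congr (_ - _).
  rewrite (bigD1 i)//= eqxx mulr1 big1 ?addr0//= => k ki.
  by rewrite eq_sym (negbTE ki) mulr0 mul0r.
rewrite le_eqVlt; apply/orP; left; apply/eqP; field.
by rewrite gt_eqF.
Qed.

Lemma gram_sym i k : gram i k = gram k i.
Proof. by rewrite /gram; apply: eq_bigr => j _; ring. Qed.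

Lemma gram_solve (b : 'I_n -> R) :
  exists u : 'I_n -> R, forall k, \sum_i u i * gram i k = b k.
Proof.
pose M := \matrix_(i, k) gram i k.
have uM : M \in unitmx.
  rewrite -row_free_unit; apply: inj_row_free => u uM.
  have h : \sum_i u 0 i ^+ 2 = 0.
    apply/eqP; rewrite eq_le; apply/andP; split; last first.
      by apply: sumr_ge0 => i _; exact: sqr_ge0.
    rewrite -(@pmulr_rle0 _ (S / 2)) ?divr_gt0//.
    apply: (le_trans (gram_quad_ge (fun i => u 0 i))).
    rewrite exchange_big/= big1// => k _.
    have := congr1 (fun w : 'rV_n => w 0 k) uM; rewrite !mxE => e.
    transitivity (u 0 k * \sum_i u 0 i * gram i k).
      by rewrite mulr_sumr; apply: eq_bigr => i _; ring.
    rewrite (_ : \sum_i u 0 i * gram i k = 0) ?mulr0//.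
    by rewrite -[RHS]e; apply: eq_bigr => i _; rewrite mxE.
  apply/rowP => i; rewrite mxE; apply/eqP; rewrite -sqrf_eq0.
  move/eqP: h; rewrite psumr_eq0 => [/allP/(_ i)|l _]; last exact: sqr_ge0.
  by rewrite mem_index_enum => /(_ isT).
have [u hu] : exists u : 'rV_n, u *m M = \row_k b k.
  by exists ((\row_k b k) *m invmx M); exact: mulmxKV.
exists (u 0) => k; have := congr1 (fun w : 'rV_n => w 0 k) hu; rewrite !mxE => <-.
by apply: eq_bigr => i _; rewrite mxE.
Qed.

Lemma radius_ge_gram (del : R) : 0 < del -> del < 1 -> 0 < sigma 0%N ->
  2 * sigma 0%N ^+ 2 * \sum_i A i 0%N ^+ 2 <= del * S ->
  ((sigma 0%N * (1 - del))%:E <= radius sigma A)%E.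
Proof.
move=> del0 del1 sig0 hS.
pose a := sigma 0%N * (1 - del).
have a0 : 0 <= a by rewrite mulr_ge0// subr_ge0 ltW.
have as0 : a <= sigma 0%N by rewrite ler_piMr// lerBlDr lerDl ltW.
have [u hu] := gram_solve (fun k => - a * A k 0%N).
(* The least-norm solution [z = B^T u] of [B z = - a A_0], with [A_0] the column [0]; its squared
   norm is the Gram quadratic form at [u]. *)
pose z j := \sum_i u i * (sigma j.+1 * A i j.+1).
have z2 : \sum_(0 <= j < m) z j ^+ 2 = - a * \sum_i u i * A i 0%N.
  transitivity (\sum_i \sum_k u i * u k * gram i k).
    under [RHS]eq_bigr do under eq_bigr do rewrite mulr_sumr.
    under [RHS]eq_bigr do rewrite exchange_big/=.
    rewrite exchange_big/=; apply: eq_bigr => j _.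
    rewrite expr2 /z mulr_suml; apply: eq_bigr => i _.
    by rewrite mulr_sumr; apply: eq_bigr => k _; ring.
  rewrite mulr_sumr; apply: eq_bigr => i _.
  transitivity (u i * \sum_k u k * gram k i).
    by rewrite mulr_sumr; apply: eq_bigr => k _; rewrite gram_sym; ring.
  by rewrite hu; ring.
have z2_le : \sum_(0 <= j < m) z j ^+ 2 <= del.
  have h1 : S / 2 * \sum_i u i ^+ 2 <= \sum_(0 <= j < m) z j ^+ 2.
    apply: (le_trans (gram_quad_ge u)); rewrite z2.
    rewrite mulr_sumr le_eqVlt; apply/orP; left; apply/eqP; apply: eq_bigr => i _.
    transitivity (u i * \sum_k u k * gram k i).
      by rewrite mulr_sumr; apply: eq_bigr => k _; rewrite gram_sym; ring.
    by rewrite hu; ring.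
  (* AM-GM on [- a * <u, A_0>], weighted so that the term in [u] is absorbed by half of the left
     side through [h1]. *)
  have h2 : \sum_(0 <= j < m) z j ^+ 2 <=
      2^-1 * (S / 2 * \sum_i u i ^+ 2 + 2 * a ^+ 2 / S * \sum_i A i 0%N ^+ 2).
    rewrite {1}z2 !mulr_sumr -big_split mulr_sumr; apply: ler_sum => i _ /=.
    have := sqr_ge0 (S * u i + 2 * a * A i 0%N).
    rewrite -(@pmulr_rge0 _ (4 * S)^-1) ?invr_gt0 ?mulr_gt0//.
    have -> : (4 * S)^-1 * (S * u i + 2 * a * A i 0%N) ^+ 2 =
      2^-1 * (S / 2 * u i ^+ 2 + 2 * a ^+ 2 / S * A i 0%N ^+ 2) - - a * (u i * A i 0%N).
      by field; rewrite gt_eqF.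
    by rewrite subr_ge0.
  have h3 : 2 * a ^+ 2 / S * \sum_i A i 0%N ^+ 2 <= del.
    rewrite mulrAC ler_pdivrMr//; apply: le_trans hS.
    rewrite ler_wpM2r ?sumr_ge0//; first by move=> i _; exact: sqr_ge0.
    by rewrite ler_wpM2l// ler_sqr ?nnegrE.
  by lra.
(* The total weight is at most [(1 - del)^2 + del <= 1]. *)
pose x j := if j is j'.+1 then (if (j' < m)%N then sigma j * z j' else 0) else a.
have Ex : ellipsoid sigma x.
  apply/ellipsoidP => //; split=> [[|j]/= sj|M].
  - by rewrite sj ltxx in sig0.
  - by case: ifP => // _; rewrite sj mul0r.
  apply: (@le_trans _ _ (\sum_(0 <= j < M.+1) (x j / sigma j) ^+ 2)).
    by rewrite big_nat_recr//= lerDl sqr_ge0.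
  rewrite big_nat_recl//=.
  have -> : a / sigma 0%N = 1 - del by rewrite /a mulrAC divff ?mul1r// gt_eqF.
  have h : \sum_(0 <= j < M) ((if (j < m)%N then sigma j.+1 * z j else 0) / sigma j.+1) ^+ 2
      <= \sum_(0 <= j < m) z j ^+ 2.
    apply: (@le_trans _ _ (\sum_(0 <= j < maxn M m) (if (j < m)%N then z j ^+ 2 else 0))).
      rewrite [leRHS](@big_cat_nat _ _ _ M)//= ?leq_maxl//.
      rewrite -[leLHS]addr0 lerD//.
        apply: ler_sum => j _; case: ifP => _; last by rewrite mul0r expr0n.
        have [sj|sj] := eqVneq (sigma j.+1) 0.
          by rewrite sj mul0r mul0r expr0n sqr_ge0.
        by rewrite mulrAC divff// mul1r.
      by apply: sumr_ge0 => j _; case: ifP => // _; exact: sqr_ge0.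
    have z0 : \sum_(m <= j < maxn M m) (if (j < m)%N then z j ^+ 2 else 0) = 0.
      by rewrite big_nat big1// => j /andP[mj _]; rewrite ltnNge mj.
    rewrite (@big_cat_nat _ _ _ m)//= ?leq_maxr// z0 addr0.
    rewrite big_nat [leRHS]big_nat; apply: ler_sum => j /andP[_ jm].
    by rewrite jm.
  have := le_trans h z2_le.
  have : (1 - del) ^+ 2 <= 1 - del.
    by rewrite expr2 ler_piMl ?subr_ge0 ?(ltW del1)// lerBlDr lerDl ltW.
  by lra.
have -> : sigma 0%N * (1 - del) = `|x 0%N| by rewrite /= ger0_norm.
apply: (radius_ge_kernel sigma_ge0 sigma_mono (m := m.+1)) => // [[|j]//= mj|i].
  by rewrite ltnNge -(ltnS m j) mj.
rewrite big_nat_recl//=.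
have -> : \sum_(0 <= j < m) A i j.+1 * (if (j < m)%N then sigma j.+1 * z j else 0) =
    \sum_k u k * gram k i.
  transitivity (\sum_(0 <= j < m) \sum_k u k * (sigma j.+1 ^+ 2 * A i j.+1 * A k j.+1)).
    rewrite big_nat [RHS]big_nat; apply: eq_bigr => j /andP[_ jm]; rewrite jm /z.
    by rewrite mulrA mulr_sumr; apply: eq_bigr => k _; ring.
  by rewrite exchange_big/=; apply: eq_bigr => k _; rewrite mulr_sumr.
by rewrite hu; ring.
Qed.

End gram.

(** * Fluctuations of the Gram matrix *)

Section gram_moments.
Context {R : realType} (sigma : nat -> R).
Hypothesis sigma_ge0 : forall j, 0 <= sigma j.
Hypothesis sigma_mono : nonincreasing_seq sigma.
Context d (T : measurableType d) (P : probability T R) (mu : set R -> \bar R)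
  (n : nat) (X : 'I_n * nat -> T -> R) (v q : R).
Hypothesis n_gt0 : (0 < n)%N.
Hypothesis iX : iid P mu X.
Hypothesis mu_sym :
  forall B : set R, measurable B -> mu ((fun x : R => - x) @^-1` B) = mu B.
Hypothesis v_gt0 : 0 < v.
Hypothesis EX2 : forall i, mean P (fun w => X i w ^+ 2) = v%:E.
Hypothesis EX4 : forall i, mean P (fun w => X i w ^+ 4) = q%:E.

Let mX ij : measurable_fun setT (X ij). Proof. exact: (proj1 iX). Qed.

Let q_ge0 : 0 <= q. Proof. exact: (q_ge0 EX4 (Ordinal n_gt0, 0%N)). Qed.

Let S (m : nat) : R := \sum_(0 <= j < m) sigma j.+1 ^+ 2.

Let dev (m : nat) (w : T) (i k : 'I_n) : R :=
  gram sigma (fun i j => X (i, j) w) m i k - v * S m * (i == k)%:R.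

Let mdev m i k : measurable_fun setT (fun w => dev m w i k).
Proof. by rewrite /dev /gram; measurable_tac. Qed.

(** The decisive gain: mean square deviations grow linearly in [S m], while the squared mean grows
    quadratically. *)
Let sum4_le m : \sum_(0 <= j < m) sigma j.+1 ^+ 4 <= sigma 0%N ^+ 2 * S m.
Proof.
rewrite mulr_sumr; apply: ler_sum => j _.
by rewrite (exprD _ 2 2) ler_wpM2r ?sqr_ge0// ler_sqr ?nnegrE// sigma_mono.
Qed.

Lemma mean_dev_offdiag m i k : i != k ->
  (mean P (fun w => dev m w i k ^+ 2)%R <= ((v ^+ 2 + q) * (sigma 0%N ^+ 2 * S m))%:E)%E.
Proof.
move=> ik.
pose c (p : 'I_n * nat) (z : array R _) : R := sigma p.2 ^+ 2 * z (k, p.2).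
have us : uniq [seq (i, j.+1) | j <- index_iota 0 m].
  by rewrite map_inj_uniq ?iota_uniq// => j1 j2 [].
have mc p : measurable_fun setT (c p) by rewrite /c; measurable_tac.
have cf p l (z : array R _) : p \in [seq (i, j.+1) | j <- index_iota 0 m] ->
    l \in [seq (i, j.+1) | j <- index_iota 0 m] -> c p (flip l z) = c p z.
  move=> _ /mapP[j _ ->]; rewrite /c /flip (_ : _ == _ = false) ?mul1r//.
  by rewrite xpair_eqE eq_sym (negbTE ik).
have := mean_sum_sqr iX mu_sym us mc cf.
under eq_mean do rewrite big_map.
rewrite (eq_mean P (g := fun w => dev m w i k ^+ 2)); last first.
  by move=> w; rewrite /dev (negbTE ik) mulr0 subr0.
move=> ->; rewrite big_map.
rewrite (eq_bigr (fun j => (v ^+ 2 * sigma j.+1 ^+ 4)%:E)); last first.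
  move=> j _; rewrite /c /=.
  rewrite (eq_mean P (g := fun w => sigma j.+1 ^+ 4 * (X (k, j.+1) w ^+ 2 * X (i, j.+1) w ^+ 2))); last first.
    by move=> w; ring.
  rewrite meanZ; last 3 first.
  - by measurable_tac.
  - by rewrite exprn_even_ge0.
  - by move=> w; rewrite mulr_ge0 ?sqr_ge0.
  rewrite (mean_cross iX v_gt0 EX2) -?EFinM 1?mulrC//.
  by rewrite xpair_eqE eq_sym (negbTE ik).
rewrite sumEFin lee_fin -mulr_sumr.
apply: (@le_trans _ _ (v ^+ 2 * (sigma 0%N ^+ 2 * S m))).
  by rewrite ler_wpM2l ?sqr_ge0.
rewrite ler_wpM2r ?lerDl// mulr_ge0 ?sqr_ge0// sumr_ge0// => j _; exact: sqr_ge0.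
Qed.

(** The variance of [D] is computed with nonnegative integrands only: the cross term [2 v S D] is
    moved to the other side of the expanded square before integrating. *)
Lemma mean_dev_diag m i :
  (mean P (fun w => dev m w i i ^+ 2)%R <= ((v ^+ 2 + q) * (sigma 0%N ^+ 2 * S m))%:E)%E.
Proof.
pose D w := \sum_(0 <= j < m) sigma j.+1 ^+ 2 * X (i, j.+1) w ^+ 2.
have D0 w : 0 <= D w by apply: sumr_ge0 => j _; rewrite mulr_ge0// sqr_ge0.
have S0 : 0 <= S m by apply: sumr_ge0 => j _; exact: sqr_ge0.
have mD : measurable_fun setT D by rewrite /D; measurable_tac.
have devE w : dev m w i i = D w - v * S m.
  rewrite /dev eqxx mulr1; congr (_ - _); apply: eq_bigr => j _; ring.
have ED : mean P D = (v * S m)%:E.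
  rewrite /D mean_sum; [|by move=> j; measurable_tac|by move=> j w; rewrite mulr_ge0// sqr_ge0].
  rewrite /S mulr_sumr -sumEFin; apply: eq_bigr => j _.
  by rewrite meanZ ?sqr_ge0//; [rewrite EX2 -EFinM mulrC|measurable_tac|move=> w; exact: sqr_ge0].
have ED2 : (mean P (fun w => D w ^+ 2)%R <= (v ^+ 2 * S m ^+ 2 + q * (sigma 0%N ^+ 2 * S m))%:E)%E.
  rewrite (eq_mean P (g := fun w => \sum_(0 <= j < m) \sum_(0 <= l < m)
      (sigma j.+1 ^+ 2 * sigma l.+1 ^+ 2) * (X (i, j.+1) w ^+ 2 * X (i, l.+1) w ^+ 2))); last first.
    move=> w; rewrite expr2 /D mulr_suml; apply: eq_bigr => j _.
    by rewrite mulr_sumr; apply: eq_bigr => l _; ring.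
  have t0 j l w : 0 <= (sigma j.+1 ^+ 2 * sigma l.+1 ^+ 2) * (X (i, j.+1) w ^+ 2 * X (i, l.+1) w ^+ 2).
    by apply: mulr_ge0; apply: mulr_ge0; exact: sqr_ge0.
  rewrite mean_sum; [|by move=> j; measurable_tac|by move=> j w; apply: sumr_ge0].
  apply: (@le_trans _ _ (\sum_(0 <= j < m) \sum_(0 <= l < m)
     ((sigma j.+1 ^+ 2 * sigma l.+1 ^+ 2) * (v ^+ 2 + q * (j == l)%:R))%:E)%E).
    apply: lee_sum => j _; rewrite mean_sum; [|by move=> l; measurable_tac|by []].
    apply: lee_sum => l _.
    rewrite meanZ; [|by measurable_tac|by apply: mulr_ge0; exact: sqr_ge0|
      by move=> w; apply: mulr_ge0; exact: sqr_ge0].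
    rewrite [leRHS]EFinM lee_wpmul2l ?lee_fin ?mulr_ge0 ?sqr_ge0//.
    have [->|jl] := eqVneq j l.
      rewrite (eq_mean P (g := fun w => X (i, l.+1) w ^+ 4)); last by move=> w; ring.
      by rewrite EX4 lee_fin mulr1 lerDr sqr_ge0.
    rewrite (mean_cross iX v_gt0 EX2) ?mulr0 ?addr0//.
    by rewrite xpair_eqE eqSS negb_and jl orbT.
  (* The diagonal term appears only when [j] lies in the range of [l], hence the test [j < m]. *)
  rewrite (eq_bigr (fun j => (sigma j.+1 ^+ 2 * v ^+ 2 * S m + (if (j < m)%N then q * sigma j.+1 ^+ 4 else 0))%:E)).
    rewrite sumEFin lee_fin big_split/=; apply: lerD.
      by rewrite -mulr_suml -mulr_suml -/(S m) le_eqVlt; apply/orP; left; apply/eqP; ring.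
    apply: (@le_trans _ _ (q * \sum_(0 <= j < m) sigma j.+1 ^+ 4)); last by rewrite ler_wpM2l.
    rewrite mulr_sumr big_nat [leRHS]big_nat; apply: ler_sum => j /andP[_ ->]; exact: lexx.
  move=> j _; rewrite sumEFin; congr (_%:E).
  under eq_bigr do rewrite mulrDr.
  rewrite big_split/=; congr (_ + _).
    rewrite /S mulr_sumr; apply: eq_bigr => l _; ring.
  case: ifP => jm.
    rewrite (bigD1_seq j)//= ?mem_index_iota ?iota_uniq// eqxx mulr1 big1 ?addr0.
      by ring.
    by move=> l lj; rewrite eq_sym (negbTE lj) !mulr0.
  rewrite big_nat big1// => l /andP[_ lm]; rewrite (_ : j == l = false) ?mulr0//.
  by apply: contraFF jm => /eqP ->.
have h : mean P (fun w => dev m w i i ^+ 2 + 2 * v * S m * D w) =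
    mean P (fun w => D w ^+ 2 + v ^+ 2 * S m ^+ 2).
  by apply: eq_mean => w; rewrite devE; ring.
have c0 : 0 <= 2 * v * S m by rewrite mulr_ge0// mulr_ge0// ltW.
have c1 : 0 <= v ^+ 2 * S m ^+ 2 by rewrite mulr_ge0 ?sqr_ge0.
rewrite meanD in h; [|by measurable_tac; exact: mdev|by measurable_tac|by move=> w; exact: sqr_ge0|
  by move=> w; apply: mulr_ge0].
rewrite [RHS]meanD in h; [|by measurable_tac|by measurable_tac|by move=> w; exact: sqr_ge0|by []].
rewrite meanZ ?ED ?mean_cst in h; [|by []|by []|by []].
have : (mean P (fun w => dev m w i i ^+ 2)%R + (2 * v * S m)%:E * (v * S m)%:E <=
   (v ^+ 2 * S m ^+ 2 + q * (sigma 0%N ^+ 2 * S m))%:E + (v ^+ 2 * S m ^+ 2)%:E)%E.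
  by rewrite h leeD2r.
rewrite -EFinM -leeBrDr// => /le_trans; apply.
apply: (@le_trans _ _ (v ^+ 2 * S m ^+ 2 + q * (sigma 0%N ^+ 2 * S m) + v ^+ 2 * S m ^+ 2 -
  2 * v * S m * (v * S m))%:E); first by rewrite EFinB EFinD.
have -> : v ^+ 2 * S m ^+ 2 + q * (sigma 0%N ^+ 2 * S m) + v ^+ 2 * S m ^+ 2 -
  2 * v * S m * (v * S m) = q * (sigma 0%N ^+ 2 * S m) by ring.
by rewrite lee_fin ler_wpM2r ?lerDr ?sqr_ge0// mulr_ge0 ?sqr_ge0.
Qed.

(** By Markov's inequality the truncation [m] fails with probability at most [C / S m]. [N] is the
    event that all truncations fail, so it is null as [S] is unbounded; off [N] some [m] depending
    on [w] succeeds. *)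
Lemma radius_ge_ae (del : R) : 0 < del -> del < 1 -> 0 < sigma 0%N ->
  (forall B, exists m, B < S m) ->
  exists N : set T, [/\ measurable N, P N = 0%E & forall w, ~ N w ->
    ((sigma 0%N * (1 - del))%:E <= radius sigma (fun i j => X (i, j) w))%E].
Proof.
move=> del0 del1 sig0 hS.
have nR : 0 < n%:R :> R by rewrite ltr0n.
(* Scaled so that [Phi m w < 1] yields both conditions of [radius_ge_gram]: Gram entries within
   [v S / (2 n)], and a first column small compared with [del * v S]. *)
pose al m : R := (2 * n%:R / (v * S m)) ^+ 2.
pose be m : R := 2 * sigma 0%N ^+ 2 / (del * (v * S m)).
pose F1 m w := \sum_i \sum_k dev m w i k ^+ 2.
pose F2 w := \sum_i X (i, 0%N) w ^+ 2.
pose Phi m w := al m * F1 m w + be m * F2 w.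
have S_ge0 m : 0 <= S m by apply: sumr_ge0 => j _; exact: sqr_ge0.
have al_ge0 m : 0 <= al m by exact: sqr_ge0.
have be_ge0 m : 0 <= be m.
  apply: divr_ge0; first by rewrite mulr_ge0// sqr_ge0.
  exact: mulr_ge0 (ltW del0) (mulr_ge0 (ltW v_gt0) (S_ge0 m)).
have F1_ge0 m w : 0 <= F1 m w.
  by apply: sumr_ge0 => i _; apply: sumr_ge0 => k _; exact: sqr_ge0.
have F2_ge0 w : 0 <= F2 w by apply: sumr_ge0 => i _; exact: sqr_ge0.
have mF1 m : measurable_fun setT (F1 m).
  by rewrite /F1; measurable_tac; exact: mdev.
have mF2 : measurable_fun setT F2 by rewrite /F2; measurable_tac.
have mPhi m : measurable_fun setT (Phi m) by rewrite /Phi; measurable_tac.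
have Phi_ge0 m w : 0 <= Phi m w by rewrite addr_ge0// mulr_ge0.
pose K := (v ^+ 2 + q) * sigma 0%N ^+ 2.
pose C := 4 * n%:R ^+ 4 * K / v ^+ 2 + 2 * sigma 0%N ^+ 2 * n%:R / del.
have EPhi m : 0 < S m -> (mean P (Phi m) <= (C / S m)%:E)%E.
  move=> Sm; rewrite /Phi meanD; [|by measurable_tac|by measurable_tac|by move=> w; rewrite mulr_ge0|
    by move=> w; rewrite mulr_ge0].
  rewrite !meanZ//.
  have E1 : (mean P (F1 m) <= (n%:R * (n%:R * (K * S m)))%:E)%E.
    rewrite /F1 mean_sum; [|by move=> i; measurable_tac; exact: mdev|
      by move=> i w; apply: sumr_ge0 => k _; exact: sqr_ge0].
    apply: (@le_trans _ _ (\sum_(i < n) (n%:R * (K * S m))%:E)%E); last first.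
      by rewrite sumEFin sumr_const card_ord -[_ *+ n]mulr_natl.
    apply: lee_sum => i _; rewrite mean_sum; [|by move=> k; measurable_tac; exact: mdev|
      by move=> k w; exact: sqr_ge0].
    apply: (@le_trans _ _ (\sum_(k < n) (K * S m)%:E)%E); last first.
      by rewrite sumEFin sumr_const card_ord -[_ *+ n]mulr_natl.
    apply: lee_sum => k _; rewrite /K -mulrA.
    by have [->|ik] := eqVneq i k; [exact: mean_dev_diag|exact: mean_dev_offdiag].
  have E2 : (mean P F2 <= (n%:R * v)%:E)%E.
    rewrite /F2 mean_sum; [|by move=> i; measurable_tac|by move=> i w; exact: sqr_ge0].
    by under eq_bigr do rewrite EX2; rewrite sumEFin sumr_const card_ord -[_ *+ n]mulr_natl.
  apply: (@le_trans _ _ ((al m)%:E * (n%:R * (n%:R * (K * S m)))%:E +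
      (be m)%:E * (n%:R * v)%:E)%E).
    by apply: leeD; apply: lee_wpmul2l; rewrite ?lee_fin.
  rewrite -!EFinM -EFinD lee_fin le_eqVlt; apply/orP; left; apply/eqP.
  rewrite /al /be /C; field.
  by rewrite !gt_eqF.
have mA m : measurable [set w | 1 <= Phi m w].
  rewrite -[X in measurable X]setTI.
  exact: (measurable_fun_ler (measurable_cst (1 : R)) (mPhi m) measurableT).
pose N := \bigcap_(m in [set m | 0 < S m]) [set w | 1 <= Phi m w].
have mN : measurable N.
  have [m0 Sm0] := hS 0.
  by apply: bigcap_measurable => [|m _]; [exists m0|exact: mA].
exists N; split => //.
  have PN m : 0 < S m -> (P N <= (C / S m)%:E)%E.
    move=> Sm; apply: le_trans (EPhi m Sm).
    apply: (@le_trans _ _ (P [set w | 1 <= Phi m w])).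
      by apply: le_measure; rewrite ?inE// => w; exact.
    rewrite -(setIT [set w | 1 <= Phi m w]) -integral_indic// -/(mean P _).
    apply: mean_le => // w; rewrite indicE.
    by case: (boolP (_ \in _)) => // /set_mem.
  have C0 : 0 <= C.
    have [m Sm] := hS 0.
    have := le_trans (measure_ge0 P N) (PN m Sm).
    by rewrite lee_fin pmulr_lge0// invr_gt0.
  apply/eqP; rewrite eq_le measure_ge0 andbT; apply/lee_addgt0Pr => e e0.
  have [m Sm] := hS (C / e); rewrite add0e.
  have Sm0 : 0 < S m by apply: le_lt_trans Sm; rewrite divr_ge0// ltW.
  apply: (le_trans (PN m Sm0)); rewrite lee_fin ler_pdivrMr//.
  by rewrite mulrC -ler_pdivrMr// ltW.
move=> w; rewrite /N => /existsNP[m] /not_implyP[Sm] /negP; rewrite -ltNge => Pm.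
have vS : 0 < v * S m by rewrite mulr_gt0.
have h1 : al m * F1 m w <= 1.
  by apply: le_trans (ltW Pm); rewrite lerDl mulr_ge0.
have h2 : be m * F2 w <= 1.
  by apply: le_trans (ltW Pm); rewrite lerDr mulr_ge0.
apply: (radius_ge_gram sigma_ge0 sigma_mono (m := m) (S := v * S m)) => //.
  move=> i k; rewrite -/(dev m w i k).
  have b0 : 0 <= v * S m / (2 * n%:R) by rewrite divr_ge0 ?mulr_ge0// ltW.
  rewrite -(ger0_norm b0) -ler_sqr ?nnegrE// !real_normK ?num_real//.
  have d1 : dev m w i k ^+ 2 <= F1 m w.
    rewrite /F1 (bigD1 i)//= (bigD1 k)//= -addrA lerDl addr_ge0//.
      by apply: sumr_ge0 => l _; exact: sqr_ge0.
    by apply: sumr_ge0 => l _; apply: sumr_ge0 => l' _; exact: sqr_ge0.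
  apply: (le_trans d1).
  have -> : F1 m w = (v * S m / (2 * n%:R)) ^+ 2 * (al m * F1 m w).
    by rewrite /al; field; rewrite !gt_eqF.
  by rewrite -[leRHS]mulr1 ler_wpM2l ?sqr_ge0.
have -> : 2 * sigma 0%N ^+ 2 * \sum_i X (i, 0%N) w ^+ 2 = del * (v * S m) * (be m * F2 w).
  by rewrite /be -/(F2 w); field; rewrite !gt_eqF.
by rewrite -[leRHS]mulr1 ler_wpM2l// mulr_ge0// ltW.
Qed.

End gram_moments.

Lemma not_ell2_unbounded {R : realType} (sigma : nat -> R) : ~ ell2 sigma ->
  forall B : R, exists m, B < \sum_(0 <= j < m) sigma j.+1 ^+ 2.
Proof.
move=> nell2 B; apply: contrapT => /forallNP hB; apply: nell2; apply/ell2P.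
exists (sigma 0%N ^+ 2 + B) => m.
apply: (@le_trans _ _ (\sum_(0 <= j < m.+1) sigma j ^+ 2)).
  by rewrite big_nat_recr//= lerDl sqr_ge0.
by rewrite big_nat_recl//= lerD2l leNgt; apply/negP; exact: hB.
Qed.

Theorem corollary6 (R : realType) (d : measure_display) (T : measurableType d)
    (P : probability T R) (g : forall n : nat, 'I_n -> nat -> {RV P >-> R})
    (hg : forall n : nat, gaussian_matrix (g n))
    (sigma : nat -> R) (sigma_ge0 : forall j : nat, 0 <= sigma j)
    (sigma_mono : nonincreasing_seq sigma) :
  (~ ell2 sigma ->
     {ae P, forall w, forall n : nat, (0 < n)%N ->
        radius_random_info sigma (g n) w = (sigma 0%N)%:E}) /\
  (ell2 sigma ->
     ((fun n : nat => ((Num.sqrt (n%:R : R))%:E *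
        \int[P]_w radius_random_info sigma (g n) w)%E) @ \oo --> 0%E)).
Proof.
split=> [nell2|]; last exact: radius_cvg0.
have [v [q [v0 vE qE]]] := @gaussian_moments R.
have unb := not_ell2_unbounded nell2.
have sig0 : 0 < sigma 0%N.
  rewrite lt_neqAle eq_sym sigma_ge0 andbT; apply/eqP => s0.
  have [m] := unb 0; rewrite big1 ?ltxx// => j _.
  have := sigma_mono _ _ (leq0n j.+1); rewrite s0 => sj.
  by rewrite (_ : sigma j.+1 = 0) ?expr0n//; apply/eqP; rewrite eq_le sj sigma_ge0.
(* The values [del = 1 / (p + 2)] lie below [1] and tend to [0]; being countably many, together with
   [n], they leave one common null set. *)
have ge_ae n p : {ae P, forall w, (0 < n)%N ->
    ((sigma 0%N * (1 - p.+2%:R^-1))%:E <= radius_random_info sigma (g n) w)%E}.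
  have [n0|n0] := ltnP 0 n; last by apply: aeW.
  have del0 : 0 < p.+2%:R^-1 :> R by rewrite invr_gt0.
  have del1 : p.+2%:R^-1 < 1 :> R by rewrite invf_lt1// ltr1n.
  have [N [mN PN hN]] := radius_ge_ae sigma_ge0 sigma_mono n0
    (gaussian_matrix_iid (hg n)) normal_prob_sym v0
    (gaussian_matrix_moment (hg n) vE isT) (gaussian_matrix_moment (hg n) qE isT) del0 del1 sig0 unb.
  exists N; split => // w /= /not_implyP[_ h]; apply: contrapT => /hN.
  exact: h.
have ge_all : {ae P, forall w, forall n p, (0 < n)%N ->
    ((sigma 0%N * (1 - p.+2%:R^-1))%:E <= radius_random_info sigma (g n) w)%E}.
  by apply: ae_foralln => n; apply: ae_foralln => p; exact: ge_ae.
apply: filterS ge_all => w hw n n0; apply/eqP; rewrite eq_le; apply/andP; split.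
  exact: radius_le_sigma0.
apply/lee_addgt0Pr => e e0.
(* Ensures [sigma 0 / (p + 2) <= e]. *)
pose p := Num.truncn (sigma 0%N / e).
apply: (@le_trans _ _ ((sigma 0%N * (1 - p.+2%:R^-1))%:E + e%:E)%E); last first.
  by rewrite leeD2r// hw.
rewrite -EFinD lee_fin mulrBr mulr1 -addrA lerDl addrC subr_ge0.
rewrite ler_pdivrMr// mulrC -ler_pdivrMr//.
have /andP[_ /ltW h] := truncn_itv (divr_ge0 (ltW sig0) (ltW e0)).
by apply: (le_trans h); rewrite ler_nat.
Qed.
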